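(* Let $\{f_1,\ldots,f_m\}$ be an affine iterated function system on $\mathbb{R}^2$ with associated self-affine set $E$, and let $\nu_p$ be the Bernoulli measure on $I^{\mathbb{N}}$, $I=\{1,\ldots,m\}$, given by a probability vector $p=(p_1,\ldots,p_m)$. Suppose that (1) there exists $\delta>0$ such that $\min\{\operatorname{dist}(f_i(E),f_j(E)) : i\neq j\}>\delta$; that is, $E$ satisfies the strong separation condition; (2) for $\nu_p$-almost all $\mathbf{i}\in I^{\mathbb{N}}$ there is $n_0\in\mathbb{N}$ such that for all $n\ge n_0$ and all $\mathbf{j}\in I^*$, the projection $\operatorname{proj}_{\overline{\vartheta}_1(\mathbf{i})}(E_{\mathbf{i}|_n\mathbf{j}})$ is a line segment; (3) the probability vector $p$ is such that the Lyapunov exponents satisfy $\lambda_1<\lambda_2$. Then for $\nu_p$-almost all $x\in E$ the tangent sets of $E$ at $x$ are either of the form $\mathcal{O}((\mathbb{R}\times C)\cap B(0,1))$, where $C$ is a closed porous set, or of the form $\mathcal{O}((\ell\times\{0\})\cap B(0,1))$, where $\ell$ is an interval containing at least one of the intervals $[-1,0]$ and $[0,1]$. Here $\mathcal{O}$ is the rotation that takes $(1,0)$ to $\overline{\vartheta}_1(\pi^{-1}(x))$.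
   Context: An affine iterated function system on $\mathbb{R}^2$ is a finite collection $\{f_1,\ldots,f_m\}$, $m\ge 2$, of maps $f_i(x)=A_ix+b_i$, where $A_i$ is an invertible real $2\times 2$ matrix of operator norm strictly less than one and $b_i\in\mathbb{R}^2$. Its self-affine set $E$ is the unique non-empty compact set with $E=\bigcup_{i=1}^m f_i(E)$. Words: $I=\{1,\ldots,m\}$, $I^*=\bigcup_{k\ge 0}I^k$ is the set of finite words (including the empty word), $|\mathbf{i}|$ is the length of $\mathbf{i}$, $\mathbf{i}(j)$ its $j$-th letter and $\mathbf{i}|_k$ its first $k$ letters. For a finite word, $A_{\mathbf{i}}=A_{\mathbf{i}(1)}\cdots A_{\mathbf{i}(|\mathbf{i}|)}$, $f_{\mathbf{i}}=f_{\mathbf{i}(1)}\circ\cdots\circ f_{\mathbf{i}(|\mathbf{i}|)}$ and $E_{\mathbf{i}}=f_{\mathbf{i}}(E)$. The canonical projection $\pi:I^{\mathbb{N}}\to E$ is $\pi(i_1,i_2,\ldots)=\sum_{n=1}^\infty A_{i_1}\cdots A_{i_{n-1}}b_{i_n}$; if the sets $f_i(E)$ are pairwise disjoint, $\pi$ is bijective. $\nu_p$ is the product measure on $I^{\mathbb{N}}$ given by $p$; via the bijection $\pi$ it is also regarded as a measure on $E$ (the pushforward). Singular values and directions: for a finite word $\mathbf{i}$, $\alpha_1(\mathbf{i})\ge\alpha_2(\mathbf{i})>0$ are the singular values of $A_{\mathbf{i}}$, and $\eta_1(\mathbf{i}),\eta_2(\mathbf{i})$ are orthogonal unit eigenvectors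 of $A_{\mathbf{i}}^TA_{\mathbf{i}}$ with eigenvalues $\alpha_1(\mathbf{i})^2,\alpha_2(\mathbf{i})^2$ (chosen arbitrarily if $\alpha_1(\mathbf{i})=\alpha_2(\mathbf{i})$; signs may be chosen freely). Put $\vartheta_k(\mathbf{i})=A_{\mathbf{i}}\eta_k(\mathbf{i})/\|A_{\mathbf{i}}\eta_k(\mathbf{i})\|$. The Lyapunov exponents $\lambda_1\le\lambda_2$ are the constants with $\lambda_k=\lim_{n\to\infty}-\frac1n\log\alpha_k(\mathbf{i}|_n)$ for $\nu_p$-almost every $\mathbf{i}$ (they exist by ergodicity). If $\lambda_1<\lambda_2$, then for $\nu_p$-almost every $\mathbf{i}$, with suitable choice of signs, the limits $\overline{\vartheta}_k(\mathbf{i})=\lim_{n\to\infty}\vartheta_k(\mathbf{i}|_n)\in S^1$ exist, $k=1,2$. For $w\in\mathbb{R}^2\setminus\{0\}$, $\operatorname{proj}_w$ is the orthogonal projection onto the line $\{tw:t\in\mathbb{R}\}$. A line segment is non-degenerate (not a single point). $B(x,r)$ is the closed ball. Tangent sets: for $x\in E$, $t>0$, let $N_{x,t}=\{(y-x)/t : y\in E\cap B(x,t)\}\subset B(0,1)$. A tangent set of $E$ at $x$ is any limit, in the Hausdorff metric, of a sequence $(N_{x,t_n})$ with $t_n\downarrow 0$. Porosity: a set $A\subset\mathbb{R}^d$ ($d=1,2$) is porous if there is $0<\alpha\le 1$ such that for every $x\in A$ and $0<r<\operatorname{diam}(A)$ there is a point $y\in\mathbb{R}^d$ with $B(y,\alpha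 r)\subset B(x,r)\setminus A$. The set $C$ above is a subset of $\mathbb{R}$.
   Formalization: The probability vector p is assumed to have strictly positive entries; with zero entries the claim can fail, e.g. when ν_p lives on an edge of E, where some tangent sets lie in a half-plane and have neither of the two forms. *)

(* Defs.v *)
From HB Require Import structures.
From mathcomp Require Import all_boot all_order all_algebra.
From mathcomp Require Import all_classical all_reals all_analysis.

Set Implicit Arguments.
Unset Strict Implicit.
Unset Printing Implicit Defensive.

Import Order.TTheory GRing.Theory Num.Theory.
Import numFieldNormedType.Exports.

Local Open Scope classical_set_scope.
Local Open Scope ring_scope.

(* The library norm on 'cV[R]_2 is the sup norm.  It is used only through the
   topology; all metric notions below use the Euclidean norm [enorm]. *)
Section Euclidean.
Variable R : realType.
Implicit Types (u v w x : 'cV[R]_2) (A B : set 'cV[R]_2).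

Definition dot u v : R := \sum_k u k 0 * v k 0.

Definition enorm v : R := Num.sqrt (dot v v).

Definition cball x (r : R) : set 'cV[R]_2 := [set y | enorm (y - x) <= r].

Definition opnorm (M : 'M[R]_2) : R :=
  sup [set enorm (M *m x) | x in cball 0 1].

Definition set_dist A B : R :=
  inf [set d | exists x y, [/\ A x, B y & d = enorm (x - y)]].

Definition hausdorff_dist A B : R :=
  inf [set e | [/\ 0 <= e,
    forall x, A x -> exists2 y, B y & enorm (x - y) <= e &
    forall y, B y -> exists2 x, A x & enorm (x - y) <= e]].

Definition proj_line w x : 'cV[R]_2 := (dot x w / dot w w) *: w.

Definition line_segment A : Prop :=
  exists u v, u != v /\ A = [set u + t *: (v - u) | t in `[0, 1]].

Definition rotation (M : 'M[R]_2) : Prop := M^T *m M = 1%:M /\ \det M = 1.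

Definition plane_prod (X Y : set R) : set 'cV[R]_2 :=
  [set z | X (z 0 0) /\ Y (z 1 0)].

Definition e1 : 'cV[R]_2 := delta_mx 0 0.

Definition magnification A x (t : R) : set 'cV[R]_2 :=
  [set t^-1 *: (y - x) | y in A `&` cball x t].

(* The Hausdorff metric lives on the nonempty compact sets; this is what makes
   the limit below unique. *)
Definition tangent_set A x (T : set 'cV[R]_2) : Prop :=
  [/\ T !=set0, compact T & exists t : nat -> R,
    [/\ forall n, 0 < t n, nonincreasing_seq t, t @ \oo --> (0 : R) &
      (fun n => hausdorff_dist (magnification A x (t n)) T) @ \oo
        --> (0 : R)]].

Definition diam (C : set R) : \bar R :=
  ereal_sup [set `|x - y|%:E | x in C & y in C].

Definition porous (C : set R) : Prop :=
  exists a : R, 0 < a <= 1 /\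
    forall x r : R, C x -> 0 < r -> (r%:E < diam C)%E ->
      exists y : R, `[y - a * r, y + a * r] `<=` `[x - r, x + r] `\` C.

(* [a k] and [e k] are the singular values and right singular vectors of [M];
   the indices 0 and 1 of 'I_2 stand for 1 and 2. *)
Definition singular_system (M : 'M[R]_2) (a : 'I_2 -> R)
    (e : 'I_2 -> 'cV[R]_2) : Prop :=
  [/\ 0 < a 1 <= a 0,
      forall k l, dot (e k) (e l) = (k == l)%:R &
      forall k, M^T *m M *m e k = (a k ^+ 2) *: e k].

End Euclidean.
Arguments e1 {R}.

Section SelfAffine.
Variables (R : realType) (m : nat).

(* m.+2 maps, so that there are at least two. *)
Local Notation I := ('I_m.+2).
Variables (A : I -> 'M[R]_2) (b : I -> 'cV[R]_2).
Implicit Types (i : nat -> I) (w : seq I).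

Definition word_mx w : 'M[R]_2 := \prod_(a <- w) A a.

Definition aff_map (a : I) (x : 'cV[R]_2) : 'cV[R]_2 := A a *m x + b a.

Definition word_map w : 'cV[R]_2 -> 'cV[R]_2 :=
  foldr (fun a g => aff_map a \o g) id w.

Definition cyl_set (E : set 'cV[R]_2) w : set 'cV[R]_2 := word_map w @` E.

Definition affine_ifs : Prop := forall a, A a \in unitmx /\ opnorm (A a) < 1.

Definition self_affine_set (E : set 'cV[R]_2) : Prop :=
  [/\ E !=set0, compact E & E = \bigcup_a (aff_map a @` E)].

Definition trunc i (n : nat) : seq I := mkseq i n.

Definition coding i : 'cV[R]_2 :=
  lim (series (fun n => word_mx (trunc i n) *m b (i n)) @ \oo).

(* [eta k w] is a choice of right singular vectors of [word_mx w]. *)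
Variable eta : 'I_2 -> seq I -> 'cV[R]_2.

Definition vtheta (k : 'I_2) w : 'cV[R]_2 :=
  (enorm (word_mx w *m eta k w))^-1 *: (word_mx w *m eta k w).

(* The limit direction, defined up to a sign, which is chosen arbitrarily
   (and 0 if no choice of signs makes the directions converge). *)
Definition vtheta_bar (k : 'I_2) i : 'cV[R]_2 :=
  xget (0 : 'cV[R]_2) [set v : 'cV[R]_2 | exists s : nat -> bool,
    (fun n => (-1) ^+ s n *: vtheta k (trunc i n)) @ \oo --> v].

End SelfAffine.

HB.instance Definition _ (n : nat) := isPointed.Build 'I_n.+1 ord0.

Definition cylinder (m : nat) (w : seq 'I_m.+2) : set (nat -> 'I_m.+2) :=
  [set i | trunc i (size w) = w].

Notation code_space m := (g_sigma_algebraType (range (@cylinder m))).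

Notation borel_plane R := (g_sigma_algebraType (@open 'cV[R]_2)).

Section Measure.
Variables (R : realType) (m : nat).

Definition bernoulli_measure (p : 'I_m.+2 -> R) (nu : probability (code_space m) R) :
    Prop :=
  forall w, nu (cylinder w) = (\prod_(a <- w) p a)%:E.

Definition lyapunov_exponents (nu : probability (code_space m) R)
    (alpha : 'I_2 -> seq 'I_m.+2 -> R) (lambda : 'I_2 -> R) : Prop :=
  forall k, {ae nu, forall i : code_space m,
    (fun n : nat => - (n%:R^-1 * ln (alpha k (trunc i n)))) @ \oo
      --> lambda k}.

End Measure.

(* Main.v *)
Require Import Defs.
From HB Require Import structures.
From mathcomp Require Import all_boot all_order all_algebra.
From mathcomp Require Import all_classical all_reals all_analysis.
From mathcomp Require Import ring lra.

Set Implicit Arguments.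
Unset Strict Implicit.
Unset Printing Implicit Defensive.

Import Order.TTheory GRing.Theory Num.Theory.
Import numFieldNormedType.Exports.

Local Open Scope classical_set_scope.
Local Open Scope ring_scope.

(** Why the theorem is true.  Fix a code [i], put [x = coding i],
    [v = vtheta_bar 0 i], write [g n] for the matrix of the prefix of [i] of
    length [n], with singular values [alpha 0 >= alpha 1], and [y n] for the
    point coded by the rest of [i].  To look at [E] in the ball of radius [t]
    about [x], let [n] be the first index with [delta * alpha 1 <= t].  By
    separation only the cylinder of the first [n] letters meets that ball, so
    the magnification is the part in the unit disc of the image of [E - y n]
    under [g n / t].  This map multiplies one direction by a factor between two
    positive constants and stretches the orthogonal direction [eta 0] by a
    factor tending to infinity, carrying it almost onto the line of [v].  So the
    magnification is a very thin strip of [E], enormously stretched across.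

    _Shape._  A small cylinder of [E] which enters the strip has, by the segment
    hypothesis, a shadow on the line of [v] which is an interval.  Either this
    interval covers [-1, 1], or it has an endpoint in the window; in the latter
    case [y n] is, in the direction [eta 0], within a constant times
    [alpha 1 / alpha 0] of an endpoint of the shadow of the cylinder.  If the
    latter happens for finitely many [n] only ([generic]), every point of the
    magnification can be moved to any abscissa in [-1, 1] at the cost of a
    vertical error as small as the cylinder, and a tangent set is a union of
    full chords of the disc parallel to [v] ([limit_fibred]).  Thus almost every
    point falls under the first alternative of the conclusion.

    _Porosity._  In the limit the strip becomes a line section of [E]: the set
    of heights of the chords lies in the set of [s] with [y + s *: d] in [E], for
    some point [y] and some [d != 0] ([limit_section]).  On a line, a cylinder
    map is a similarity, so separation leaves beside every cylinder piece of the
    section a gap comparable with the size of the piece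
    ([porous_line_section]).

    _Genericity._  The hypothesis on the Lyapunov exponents makes
    [alpha 1 / alpha 0] decay exponentially ([ratio_decay]).  The direction
    [eta 0] at stage [n] is determined by the first [n] letters and [y n] by the
    others, so by Borel-Cantelli it suffices that the mass of a strip be at most
    a power of its width, uniformly over all strips ([strip_mass]).  As [E] is
    not contained in a line ([segment_projection_noncollinear]), every thin strip
    misses a cylinder of some fixed level; pulling back by a cylinder map widens
    a strip by a bounded factor only, and one iterates.

    The limit direction exists because projecting onto the junk value 0 of
    [vtheta_bar] would not give segments.  Finally the coding map is a bijection
    onto [E] that carries measurable sets to Borel sets, which turns statements
    about almost every code into statements about almost every point
    ([coding_ae]). *)

(** * The Euclidean plane *)

Section EuclideanGeometry.
Variable R : realType.
Implicit Types (u v w x y : 'cV[R]_2) (M : 'M[R]_2).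

Lemma ord2P (i : 'I_2) : i = 0 \/ i = 1.
Proof. by case: i => [[|[|//]]] ?; [left|right]; apply/val_inj. Qed.

Lemma sum_ord2 (V : nmodType) (F : 'I_2 -> V) : \sum_i F i = F 0 + F 1.
Proof. by rewrite !big_ord_recl big_ord0 addr0; congr (F _ + F _); apply/val_inj. Qed.

Lemma dotE u v : dot u v = u 0 0 * v 0 0 + u 1 0 * v 1 0.
Proof. exact: sum_ord2. Qed.

Lemma cV2P u v : u 0 0 = v 0 0 -> u 1 0 = v 1 0 -> u = v.
Proof.
move=> h0 h1; apply/matrixP => i j; rewrite (ord1 j).
by have [->|->] := ord2P i.
Qed.

Lemma dotC u v : dot u v = dot v u.
Proof. by rewrite !dotE; ring. Qed.
Lemma dotDl u v w : dot (u + v) w = dot u w + dot v w.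
Proof. by rewrite !dotE !mxE; ring. Qed.
Lemma dotDr u v w : dot w (u + v) = dot w u + dot w v.
Proof. by rewrite !dotE !mxE; ring. Qed.
Lemma dotBl u v w : dot (u - v) w = dot u w - dot v w.
Proof. by rewrite !dotE !mxE; ring. Qed.
Lemma dotZl a u v : dot (a *: u) v = a * dot u v.
Proof. by rewrite !dotE !mxE; ring. Qed.
Lemma dotZr a u v : dot u (a *: v) = a * dot u v.
Proof. by rewrite !dotE !mxE; ring. Qed.
Lemma dot_mulmx M u v : dot (M *m u) v = dot u (M^T *m v).
Proof.
by rewrite !dotE !mxE !sum_ord2 !mxE; ring.
Qed.

Lemma dot_ge0 u : 0 <= dot u u.
Proof. by rewrite dotE; nra. Qed.
Lemma enorm_ge0 u : 0 <= enorm u.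
Proof. exact: sqrtr_ge0. Qed.
Lemma enorm_sqr u : enorm u ^+ 2 = dot u u.
Proof. exact/sqr_sqrtr/dot_ge0. Qed.
Lemma enorm0 : enorm 0 = 0 :> R.
Proof. by rewrite /enorm dotE !mxE mulr0 addr0 sqrtr0. Qed.
Lemma enorm_eq0 u : enorm u = 0 -> u = 0.
Proof.
move=> h; have := enorm_sqr u; rewrite h dotE expr2 mul0r => e.
by apply: cV2P; rewrite mxE; nra.
Qed.
Lemma enorm_gt0 u : u != 0 -> 0 < enorm u.
Proof.
move=> u0; rewrite lt_neqAle enorm_ge0 andbT eq_sym.
by apply: contra u0 => /eqP /enorm_eq0 ->.
Qed.
Lemma enormZ a u : enorm (a *: u) = `|a| * enorm u.
Proof.
by rewrite /enorm dotZl dotZr mulrA -expr2 sqrtrM ?sqr_ge0// sqrtr_sqr.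
Qed.
Lemma enormN u : enorm (- u) = enorm u.
Proof. by rewrite -scaleN1r enormZ normrN1 mul1r. Qed.
Lemma enormBC u v : enorm (u - v) = enorm (v - u).
Proof. by rewrite -opprB enormN. Qed.

Lemma dot_le_enorm u v : `|dot u v| <= enorm u * enorm v.
Proof.
rewrite -(@ler_pXn2r _ 2%N)// ?nnegrE ?mulr_ge0 ?enorm_ge0//.
rewrite exprMn !enorm_sqr real_normK ?num_real// -subr_ge0 !dotE.
set d := (X in 0 <= X).
suff -> : d = (u 0 0 * v 1 0 - u 1 0 * v 0 0) ^+ 2 by apply: sqr_ge0.
by rewrite /d; ring.
Qed.

Lemma enormD u v : enorm (u + v) <= enorm u + enorm v.
Proof.
rewrite -(@ler_pXn2r _ 2%N)// ?nnegrE ?addr_ge0 ?enorm_ge0//.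
rewrite sqrrD !enorm_sqr dotDl !dotDr (dotC v u).
have := dot_le_enorm u v; have := ler_norm (dot u v); lra.
Qed.

Lemma enormB u v : enorm (u - v) <= enorm u + enorm v.
Proof. by rewrite -(enormN v) enormD. Qed.

Lemma enorm_triangle v u w : enorm (u - w) <= enorm (u - v) + enorm (v - w).
Proof. by have := enormD (u - v) (v - w); rewrite addrA subrK. Qed.

Lemma enorm_entry u i : `|u i 0| <= enorm u.
Proof.
rewrite -(@ler_pXn2r _ 2%N)// ?nnegrE ?enorm_ge0//.
rewrite enorm_sqr real_normK ?num_real// dotE.
by have [->|->] := ord2P i; nra.
Qed.

Lemma enorm_le_entries u : enorm u <= `|u 0 0| + `|u 1 0|.
Proof.
rewrite -(@ler_pXn2r _ 2%N)// ?nnegrE ?enorm_ge0// ?addr_ge0//.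
rewrite enorm_sqr dotE sqrrD !real_normK ?num_real//.
have := mulr_ge0 (normr_ge0 (u 0 0)) (normr_ge0 (u 1 0)); lra.
Qed.

Lemma enorm_mulmx_bounded M : exists2 K : R, 0 < K &
  forall x, enorm (M *m x) <= K * enorm x.
Proof.
exists (1 + \sum_i \sum_j `|M i j|).
  by rewrite ltr_wpDr// sumr_ge0// => i _; rewrite sumr_ge0.
move=> x; apply: le_trans (enorm_le_entries _) _.
have h i : `|(M *m x) i 0| <= (\sum_j `|M i j|) * enorm x.
  rewrite mxE mulr_suml; apply: le_trans (ler_norm_sum _ _ _) _.
  by apply: ler_sum => j _; rewrite normrM ler_wpM2l// enorm_entry.
rewrite mulrDl mul1r sum_ord2 mulrDl.
by have := h 0; have := h 1; have := enorm_ge0 x; lra.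
Qed.

Lemma enorm_mulmx_le M x : enorm (M *m x) <= opnorm M * enorm x.
Proof.
have [K K0 hK] := enorm_mulmx_bounded M.
have [->|x0] := eqVneq x 0; first by rewrite mulmx0 enorm0 mulr0.
have xp := enorm_gt0 x0.
have : enorm (M *m ((enorm x)^-1 *: x)) <= opnorm M.
  apply: ub_le_sup.
    exists K => _ [y + <-]; rewrite /cball/= subr0 => hy.
    by apply: le_trans (hK y) _; rewrite ler_piMr// ltW.
  exists ((enorm x)^-1 *: x) => //.
  by rewrite /cball/= subr0 enormZ gtr0_norm ?invr_gt0// mulVf// gt_eqF.
rewrite -scalemxAr enormZ gtr0_norm ?invr_gt0//.
by rewrite mulrC ler_pdivrMr.
Qed.

(** The rotation by a quarter turn; [v] and [perp v] give the frame in which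
    tangent sets are described. *)
Definition perp v : 'cV[R]_2 := \col_i (if i == 0 then - v 1 0 else v 0 0).

Lemma perpE v : (perp v 0 0 = - v 1 0) * (perp v 1 0 = v 0 0).
Proof. by rewrite !mxE. Qed.

Lemma dot_perp v : dot v (perp v) = 0.
Proof. by rewrite dotE !perpE; ring. Qed.

Lemma dot_perp_perp v w : dot (perp v) (perp w) = dot v w.
Proof. by rewrite !dotE !perpE; ring. Qed.

Lemma enorm_perp v : enorm (perp v) = enorm v.
Proof. by rewrite /enorm dot_perp_perp. Qed.

Lemma perp_decomp v x : dot v v = 1 ->
  x = dot x v *: v + dot x (perp v) *: perp v.
Proof.
rewrite dotE => h; apply: cV2P; rewrite [RHS]mxE [X in X + _]mxE [X in _ + X]mxE;
  rewrite !perpE !dotE !perpE.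
- by rewrite -[LHS]mulr1 -h; ring.
- by rewrite -[LHS]mulr1 -h; ring.
Qed.

Lemma dot_perp_sqr v x : dot v v = 1 ->
  dot x x = dot x v ^+ 2 + dot x (perp v) ^+ 2.
Proof.
move=> h; rewrite [in LHS](perp_decomp x h) dotDl !dotDr !dotZl !dotZr.
by rewrite dot_perp_perp (dotC (perp v)) dot_perp h; ring.
Qed.

Lemma perp_parallel (d y : 'cV[R]_2) : dot d (perp y) = 0 -> dot y d *: d = dot d d *: y.
Proof.
rewrite !dotE !perpE => h; apply: cV2P; rewrite [LHS]mxE [RHS]mxE.
- by rewrite -[LHS]addr0 -[X in _ + X](mulr0 (d 1 0)) -h; ring.
- by rewrite -[LHS]subr0 -[X in _ - X](mulr0 (d 0 0)) -h; ring.
Qed.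

(** Cramer's rule: two independent vectors detect the size of any third one. *)
Lemma dot_perp_bound (u v : 'cV[R]_2) : dot u (perp v) != 0 -> exists2 K : R, 0 < K &
  forall f, enorm f <= K * (`|dot u f| + `|dot v f|).
Proof.
set d := dot u (perp v) => d0.
exists (`|d|^-1 * (enorm u + enorm v + 1)).
  by rewrite mulr_gt0 ?invr_gt0 ?normr_gt0// ltr_wpDl// addr_ge0// enorm_ge0.
move=> f; have e : d *: f = dot u f *: perp v - dot v f *: perp u.
  by apply: cV2P; rewrite !mxE /d !dotE ?perpE ?mxE/=; ring.
have h : `|d| * enorm f <= (enorm u + enorm v + 1) * (`|dot u f| + `|dot v f|).
  rewrite -enormZ e; apply: le_trans (enormB _ _) _.
  rewrite !enormZ !enorm_perp.
  have := mulr_ge0 (normr_ge0 (dot u f)) (enorm_ge0 u).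
  have := mulr_ge0 (normr_ge0 (dot v f)) (enorm_ge0 v).
  have := normr_ge0 (dot u f); have := normr_ge0 (dot v f).
  by lra.
by rewrite -mulrA ler_pdivlMl ?normr_gt0.
Qed.

End EuclideanGeometry.

(** * Singular value decomposition of a plane matrix *)

Section SingularValues.
Variable R : realType.
Implicit Types (u v x y : 'cV[R]_2).

Lemma orthonormal_decomp u v x : dot u u = 1 -> dot v v = 1 -> dot u v = 0 ->
  x = dot x u *: u + dot x v *: v.
Proof.
move=> uu vv uv; rewrite {1}(perp_decomp x uu); congr (_ + _).
have e : v = dot v (perp u) *: perp u.
  by rewrite {1}(perp_decomp v uu) dotC uv scale0r add0r.
move: (dot v _) e => c e.
have c1 : c * c = 1 by move: vv; rewrite e dotZl dotZr dot_perp_perp uu mulr1.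
by rewrite e dotZr scalerA mulrAC c1 mul1r.
Qed.

Lemma orthonormal_sqr u v x : dot u u = 1 -> dot v v = 1 -> dot u v = 0 ->
  dot x x = dot x u ^+ 2 + dot x v ^+ 2.
Proof.
move=> uu vv uv; rewrite [in LHS](orthonormal_decomp x uu vv uv).
by rewrite dotDl !dotDr !dotZl !dotZr uu vv (dotC v) uv; ring.
Qed.

Variables (M : 'M[R]_2) (a : 'I_2 -> R) (e : 'I_2 -> 'cV[R]_2).
Hypothesis hs : singular_system M a e.

Definition left_singular k : 'cV[R]_2 := (enorm (M *m e k))^-1 *: (M *m e k).

Lemma sv_gt0 k : 0 < a k.
Proof. by case: hs => /andP[a1 a10] _ _; have [->|->] := ord2P k => //; apply: lt_le_trans a10. Qed.

Lemma sv_le : a 1 <= a 0.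
Proof. by case: hs => /andP[]. Qed.

Lemma sv_orth k l : dot (e k) (e l) = (k == l)%:R.
Proof. by case: hs. Qed.

Lemma dot_sv_image x k : dot (M *m x) (M *m e k) = a k ^+ 2 * dot x (e k).
Proof. by case: hs => _ _ h; rewrite dot_mulmx mulmxA h dotZr. Qed.

Lemma enorm_sv_image k : enorm (M *m e k) = a k.
Proof.
rewrite /enorm dot_sv_image sv_orth eqxx mulr1 sqrtr_sqr gtr0_norm//.
exact: sv_gt0.
Qed.

(** The coordinates of [M *m x] in the left singular frame are those of [x] in
    the right one, scaled; every estimate on [M] and its inverse below is read
    off from this identity. *)
Lemma dot_left_singular x k : dot (M *m x) (left_singular k) = a k * dot x (e k).
Proof.
rewrite /left_singular dotZr dot_sv_image enorm_sv_image expr2 !mulrA.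
by rewrite mulVf ?mul1r// gt_eqF// sv_gt0.
Qed.

Lemma left_singular_orth k l : dot (left_singular k) (left_singular l) = (k == l)%:R.
Proof.
rewrite {1}/left_singular dotZl dot_left_singular sv_orth enorm_sv_image.
by have [->|] := eqVneq k l; rewrite ?mulr1 ?mulr0// mulVf// gt_eqF// sv_gt0.
Qed.

Lemma sv_decomp x : x = dot x (e 0) *: e 0 + dot x (e 1) *: e 1.
Proof. by apply: orthonormal_decomp; rewrite sv_orth. Qed.

Lemma dot_mulmx_sv x v : dot (M *m x) v =
  a 0 * dot x (e 0) * dot v (left_singular 0) + a 1 * dot x (e 1) * dot v (left_singular 1).
Proof.
rewrite -!dot_left_singular; move: (M *m x) => y.
rewrite [in LHS](@orthonormal_decomp (left_singular 0) (left_singular 1) y) ?left_singular_orth//.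
by rewrite dotDl (dotZl _ (left_singular 0)) (dotZl _ (left_singular 1)) !(dotC v).
Qed.

Lemma enorm_mulmx_ge x : a 1 * enorm x <= enorm (M *m x).
Proof.
have a1 := sv_gt0 1; have a0 := sv_gt0 0; have a10 := sv_le.
rewrite -(@ler_pXn2r _ 2%N)// ?nnegrE ?mulr_ge0 ?enorm_ge0 ?(ltW a1) ?(ltW a0)//.
rewrite exprMn !enorm_sqr.
rewrite (@orthonormal_sqr (left_singular 0) (left_singular 1) (M *m x)) ?left_singular_orth//.
rewrite (@orthonormal_sqr (e 0) (e 1) x) ?sv_orth// !dot_left_singular !exprMn.
rewrite mulrDr lerD2r ler_wpM2r ?sqr_ge0// ler_pXn2r// ?nnegrE ?(ltW a1) ?(ltW a0)//.
Qed.

Lemma enorm_preimage_le x : enorm x <=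
  `|dot (M *m x) (left_singular 0)| / a 0 + `|dot (M *m x) (left_singular 1)| / a 1.
Proof.
rewrite {1}(sv_decomp x); apply: le_trans (enormD _ _) _.
have h k : enorm (e k) = 1 by rewrite /enorm sv_orth eqxx sqrtr1.
rewrite !enormZ !h !mulr1 !dot_left_singular !normrM.
have h' k : `|a k| = a k by rewrite gtr0_norm// sv_gt0.
by rewrite !h' -!(mulrC (a _)^-1) !mulrA !mulVf ?mul1r// gt_eqF// sv_gt0.
Qed.

Lemma enorm_preimage_ge x : `|dot (M *m x) (left_singular 1)| / a 1 <= enorm x.
Proof.
have a1 := sv_gt0 1.
rewrite dot_left_singular normrM gtr0_norm// mulrAC mulfV ?gt_eqF// mul1r.
apply: le_trans (dot_le_enorm _ _) _.
by rewrite /enorm sv_orth eqxx sqrtr1 mulr1.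
Qed.

End SingularValues.

(** * Convergence in the Euclidean norm *)

Section Topology.
Variable R : realType.
Implicit Types (u v x : 'cV[R]_2).

(** The topology of the plane is defined by the sup norm; the Euclidean norm
    defines the same limits, and from here on only the latter is used. *)
Lemma enorm_cvgP (T : Type) (F : set_system T) {FF : Filter F} (f : T -> 'cV[R]_2) x :
  f @ F --> x <-> forall e : R, 0 < e -> \forall t \near F, enorm (f t - x) < e.
Proof.
split=> [h e e0|h].
  have e20 : 0 < e / 2 by rewrite divr_gt0.
  move/cvgrPdist_lt : h => /(_ _ e20); apply: filterS => t ht.
  apply: le_lt_trans (enorm_le_entries _) _.
  have hi i : `|(f t - x) i 0| < e / 2.
    apply: le_lt_trans ht; rewrite distrC [leRHS]/Num.norm/= mx_normrE.
    exact: (le_bigmax _ (fun ij => `|(f t - x) ij.1 ij.2|) (i, 0)).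
  by have := hi 0; have := hi 1; lra.
apply/cvgrPdist_lt => e e0; move: (h _ e0); apply: filterS => t ht.
rewrite distrC; rewrite [ltLHS]/Num.norm/= mx_normrE.
apply: bigmax_lt => //= ij _; apply: le_lt_trans ht.
by case: ij => i j /=; rewrite (ord1 j) enorm_entry.
Qed.

Lemma dot_cvg (T : Type) (F : set_system T) {FF : Filter F} (f g : T -> 'cV[R]_2) x y :
  f @ F --> x -> g @ F --> y -> (fun t => dot (f t) (g t)) @ F --> dot x y.
Proof.
move=> fx gy; rewrite (_ : (fun t => _) = (fun t => f t 0 0 * g t 0 0 + f t 1 0 * g t 1 0)).
  rewrite dotE.
  have c (h : T -> 'cV[R]_2) (z : 'cV[R]_2) i : h @ F --> z -> (fun t => h t i 0) @ F --> z i 0.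
    by move=> hz; exact: (cvg_comp _ _ hz (@coord_continuous R _ _ i 0 z)).
  by apply: cvgD; apply: cvgM; apply: c.
by apply/funext => t; rewrite dotE.
Qed.

Lemma mulmx_cont (M : 'M[R]_2) : continuous (mulmx M : 'cV[R]_2 -> 'cV[R]_2).
Proof.
move=> x; apply/(@enorm_cvgP _ (nbhs x) (nbhs_filter x)) => e e0.
have [K K0 hK] := enorm_mulmx_bounded M.
have /(@enorm_cvgP _ (nbhs x) (nbhs_filter x) id)/(_ _ (divr_gt0 e0 K0)) := (@cvg_id _ (nbhs x)).
apply: filterS => y hy; rewrite -mulmxBr.
by apply: le_lt_trans (hK _) _; rewrite mulrC -ltr_pdivlMr.
Qed.

Lemma closed_enorm (E : set 'cV[R]_2) x : closed E ->
  (forall e : R, 0 < e -> exists2 y, E y & enorm (y - x) < e) -> E x.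
Proof.
move=> cE h; apply: cE => B /nbhs_ballP[e /= e0 hB].
have [y Ey yx] := h _ e0; exists y; split => //; apply: hB.
rewrite -ball_normE /ball_/= [ltLHS]/Num.norm/= mx_normrE.
apply: bigmax_lt => //= ij _; apply: le_lt_trans yx.
by case: ij => i j /=; rewrite (ord1 j) enormBC enorm_entry.
Qed.

Lemma compact_enorm_bounded (E : set 'cV[R]_2) : compact E ->
  exists2 D : R, 0 < D & forall x y, E x -> E y -> enorm (x - y) <= D.
Proof.
move=> /compact_bounded[M [Mr hM]].
have M1 : M < `|M| + 1 by rewrite (le_lt_trans (ler_norm _))// ltrDl.
have hE x : E x -> enorm x <= 2 * (`|M| + 1).
  move=> Ex; apply: le_trans (enorm_le_entries _) _.
  have hi i : `|x i 0| <= `|M| + 1.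
    apply: le_trans (hM _ M1 _ Ex); rewrite [leRHS]/Num.norm/= mx_normrE.
    exact: (le_bigmax _ (fun ij => `|x ij.1 ij.2|) (i, 0)).
  by have := hi 0; have := hi 1; lra.
exists (4 * (`|M| + 1)); first by rewrite mulr_gt0// ltr_wpDl.
move=> x y Ex Ey; apply: le_trans (enormB _ _) _.
by have := hE _ Ex; have := hE _ Ey; lra.
Qed.

Lemma expr_small (z C e : R) : 0 < z < 1 -> 0 < e -> \forall n \near \oo, z ^+ n * C < e.
Proof.
move=> /andP[z0 z1] e0; have h : (fun n => z ^+ n * C) @ \oo --> 0 * C.
  by apply: cvgM; [apply: cvg_expr; rewrite gtr0_norm|exact: cvg_cst].
move/cvgrPdist_lt : h => /(_ _ e0); apply: filterS => n.
by rewrite mul0r sub0r normrN; apply: le_lt_trans; exact: ler_norm.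
Qed.

End Topology.

(** * Uniform contraction and expansion rates *)

Section Constants.
Variables (R : realType) (m : nat) (A : 'I_m.+2 -> 'M[R]_2).
Hypothesis hA : affine_ifs A.

Lemma ifs_contraction : exists2 rho : R, 0 < rho < 1 &
  forall a x, enorm (A a *m x) <= rho * enorm x.
Proof.
exists (\big[Num.max/2^-1]_a opnorm (A a)).
  apply/andP; split.
    by apply: lt_le_trans (bigmax_ge_id _ _ _ _); rewrite invr_gt0.
  apply: bigmax_lt; first by rewrite invf_lt1 ?ltr1n.
  by move=> a _; case: (hA a).
move=> a x; apply: le_trans (enorm_mulmx_le _ _) _.
by rewrite ler_wpM2r ?enorm_ge0// le_bigmax.
Qed.

Lemma ifs_expansion : exists2 kappa : R, 1 <= kappa &
  forall a x, enorm x <= kappa * enorm (A a *m x).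
Proof.
exists (\big[Num.max/1]_a opnorm (invmx (A a))).
  exact: bigmax_ge_id.
move=> a x; rewrite -{1}(mul1mx x) -(mulVmx (proj1 (hA a))) -mulmxA.
apply: le_trans (enorm_mulmx_le _ _) _.
by rewrite ler_wpM2r ?enorm_ge0// le_bigmax.
Qed.

End Constants.

(** * Codes and their prefixes *)

Section Sequences.
Variable m : nat.
Local Notation I := ('I_m.+2).
Implicit Types (i j : nat -> I) (w : seq I).

Definition shift n i : nat -> I := fun k => i (n + k)%N.

Definition catw w i : nat -> I :=
  fun k => if (k < size w)%N then nth ord0 w k else i (k - size w)%N.

Lemma size_trunc i n : size (trunc i n) = n.
Proof. exact: size_mkseq. Qed.

Lemma trunc_add i n k : trunc i (n + k) = trunc i n ++ trunc (shift n i) k.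
Proof.
rewrite /trunc /mkseq iotaD map_cat add0n; congr (_ ++ _).
by rewrite -[in LHS](addn0 n) iotaDl -map_comp.
Qed.

Lemma truncS i n : trunc i n.+1 = rcons (trunc i n) (i n).
Proof. exact: mkseqS. Qed.

Lemma trunc_catw w i : trunc (catw w i) (size w) = w.
Proof.
apply: (@eq_from_nth _ ord0); rewrite size_trunc// => k kw.
by rewrite nth_mkseq// /catw kw.
Qed.

Lemma shift_catw w i : shift (size w) (catw w i) = i.
Proof. by apply/funext => k; rewrite /shift /catw ltnNge leq_addr/= addKn. Qed.

Lemma take_trunc i n k : (n <= k)%N -> take n (trunc i k) = trunc i n.
Proof. by move=> nk; rewrite -(subnKC nk) trunc_add take_size_cat// size_trunc. Qed.

Lemma trunc_first_diff i j n : trunc i n <> trunc j n ->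
  exists q, [/\ (q < n)%N, trunc i q = trunc j q & i q != j q].
Proof.
elim: n => // n IH; have [e|ne] := EM (trunc i n = trunc j n).
  rewrite !truncS e => h; exists n; split => //.
  by apply: contra_notN h => /eqP ->.
by have [q [qn *]] := IH ne; exists q; split => //; apply: ltnW.
Qed.

End Sequences.

(** * The coding map of a strongly separated system *)

(** Quantitative form of the assumptions on the system: [rho] and [kappa] bound
    the contraction of the maps from above and below, [D] bounds the diameter
    of the attractor and [delta] is the gap between its first-level pieces. *)
Record separated_ifs (R : realType) (m : nat) (A : 'I_m.+2 -> 'M[R]_2)
    (b : 'I_m.+2 -> 'cV[R]_2) (E : set 'cV[R]_2) (rho kappa D delta : R) : Prop :=
  SeparatedIFS {
  matrix_unit : forall a, A a \in unitmx;
  contr_gt0 : 0 < rho;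
  contr_lt1 : rho < 1;
  contr_le : forall a x, enorm (A a *m x) <= rho * enorm x;
  expand_ge1 : 1 <= kappa;
  expand_le : forall a x, enorm x <= kappa * enorm (A a *m x);
  diam_gt0 : 0 < D;
  diam_le : forall x y, E x -> E y -> enorm (x - y) <= D;
  attractor : self_affine_set A b E;
  gap_gt0 : 0 < delta;
  gap_lt : forall a a' x y, a != a' -> E x -> E y ->
    delta < enorm (aff_map A b a x - aff_map A b a' y) }.

Section Coding.
Variables (R : realType) (m : nat).
Local Notation I := ('I_m.+2).
Variables (A : I -> 'M[R]_2) (b : I -> 'cV[R]_2) (E : set 'cV[R]_2).
Variables (rho kappa D delta : R).
Hypothesis H : separated_ifs A b E rho kappa D delta.
Let rho0 := contr_gt0 H.
Let rho1 := contr_lt1 H.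
Let A_contr := contr_le H.
Let kappa1 := expand_ge1 H.
Let A_exp := expand_le H.
Let D0 := diam_gt0 H.
Let diamE := diam_le H.
Let hE := attractor H.
Let delta0 := gap_gt0 H.
Let sepE := gap_lt H.
Implicit Types (i j : nat -> I) (w : seq I) (x y : 'cV[R]_2).

Local Notation mx := (word_mx A).
Local Notation wmap := (word_map A b).
Local Notation cyl := (cyl_set A b E).
Local Notation pi := (coding A b).

Lemma word_mx_cons a w : mx (a :: w) = A a *m mx w.
Proof. by rewrite /word_mx big_cons. Qed.

Lemma word_mx_cat w w' : mx (w ++ w') = mx w *m mx w'.
Proof. by rewrite /word_mx big_cat. Qed.

Lemma word_map_cat w w' x : wmap (w ++ w') x = wmap w (wmap w' x).
Proof. by elim: w => //= a w ->. Qed.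

Lemma word_mapB w x y : wmap w x - wmap w y = mx w *m (x - y).
Proof.
elim: w => [|a w IH] /=; first by rewrite /word_mx big_nil mul1mx.
by rewrite word_mx_cons -mulmxA -IH /aff_map opprD addrACA subrr addr0 mulmxBr.
Qed.

Lemma word_mapE w x : wmap w x = mx w *m x + wmap w 0.
Proof. by rewrite -[x in RHS]subr0 -word_mapB subrK. Qed.

Lemma word_mx_contr w x : enorm (mx w *m x) <= rho ^+ size w * enorm x.
Proof.
elim: w => [|a w IH]; first by rewrite /word_mx big_nil mul1mx expr0 mul1r.
rewrite word_mx_cons -mulmxA exprS -mulrA; apply: le_trans (A_contr _ _) _.
by rewrite ler_wpM2l// ltW.
Qed.

Lemma kappa0 : 0 < kappa.
Proof. exact: lt_le_trans kappa1. Qed.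

Lemma word_mx_exp w x : enorm x <= kappa ^+ size w * enorm (mx w *m x).
Proof.
elim: w x => [|a w IH] x; first by rewrite /word_mx big_nil mul1mx expr0 mul1r.
apply: le_trans (IH _) _; rewrite word_mx_cons -mulmxA exprSr -mulrA.
by rewrite ler_wpM2l ?A_exp// exprn_ge0// ltW// kappa0.
Qed.

Lemma word_map_inj w x y : wmap w x = wmap w y -> x = y.
Proof.
move=> e; apply/subr0_eq/enorm_eq0/eqP; rewrite eq_le enorm_ge0 andbT.
by have := word_mx_exp w (x - y); rewrite -word_mapB e subrr enorm0 mulr0.
Qed.

Lemma word_mx_unit w : mx w \in unitmx.
Proof.
elim: w => [|a w IH]; first by rewrite /word_mx big_nil unitmx1.
by rewrite word_mx_cons unitmx_mul (matrix_unit H).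
Qed.

Lemma E_compact : compact E. Proof. by case: hE. Qed.

Lemma E_closed : closed E.
Proof. exact: compact_closed (@norm_hausdorff _ _) E_compact. Qed.

Lemma aff_map_E a x : E x -> E (aff_map A b a x).
Proof. by move=> Ex; case: hE => _ _ ->; exists a => //; exists x. Qed.

Lemma word_map_E w x : E x -> E (wmap w x).
Proof. by move=> Ex; elim: w => //= a w; apply: aff_map_E. Qed.

Lemma cyl_sub_E w : cyl w `<=` E.
Proof. by move=> _ [x Ex <-]; apply: word_map_E. Qed.

Lemma cyl_cat_sub w w' : cyl (w ++ w') `<=` cyl w.
Proof.
by move=> _ [x Ex <-]; exists (wmap w' x); rewrite ?word_map_cat//; exact: word_map_E.
Qed.

Lemma cyl_diam w x y : cyl w x -> cyl w y -> enorm (x - y) <= rho ^+ size w * D.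
Proof.
move=> [x' Ex <-] [y' Ey <-]; rewrite word_mapB.
apply: le_trans (word_mx_contr _ _) _.
by rewrite ler_wpM2l ?exprn_ge0 ?(ltW rho0)//; exact: diamE.
Qed.

Lemma word_map_cont w : continuous (wmap w).
Proof.
move=> x; rewrite (_ : wmap w = fun z => mx w *m z + wmap w 0); last first.
  by apply/funext => z; rewrite -word_mapE.
by apply: (@continuousD _ _ _ (mulmx (mx w)) (cst (wmap w 0)));
  [exact: mulmx_cont|exact: cst_continuous].
Qed.

Lemma cyl_compact w : compact (cyl w).
Proof.
apply: continuous_compact E_compact.
by apply: continuous_subspaceT => x; exact: word_map_cont.
Qed.

Lemma cyl_closed w : closed (cyl w).
Proof. exact: compact_closed (@norm_hausdorff _ _) (@cyl_compact w). Qed.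

Lemma rho_small (C e : R) : 0 < e -> \forall n \near \oo, rho ^+ n * C < e.
Proof.
by apply: expr_small; rewrite rho0.
Qed.

Lemma coding_series i n :
  series (fun k => mx (trunc i k) *m b (i k)) n = wmap (trunc i n) 0.
Proof.
elim: n => [|n IH]; first by rewrite /series/= big_geq.
rewrite seriesSr IH truncS -cats1 word_map_cat/= [RHS]word_mapE addrC.
by rewrite /aff_map mulmx0 add0r.
Qed.

Lemma cyl_trunc_mono i n k x : (n <= k)%N -> cyl (trunc i k) x -> cyl (trunc i n) x.
Proof. by move=> nk; rewrite -(subnKC nk) trunc_add; apply: cyl_cat_sub. Qed.

Lemma coding_unique i x : (forall n, cyl (trunc i n) x) -> pi i = x.
Proof.
move=> h; rewrite /coding; apply: cvg_lim; first exact: norm_hausdorff.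
apply/enorm_cvgP => e e0.
have := @rho_small (enorm x + D) e e0; apply: filterS => n.
apply: le_lt_trans; rewrite coding_series.
have [x' Ex' e'] := h n; rewrite -[X in _ - X]e' word_mapB sub0r.
apply: le_trans (word_mx_contr _ _) _; rewrite size_trunc enormN.
rewrite ler_wpM2l ?exprn_ge0 ?(ltW rho0)//.
have Ex : E x := cyl_sub_E (h 0%N).
by have := enormD x (x' - x); have := diamE Ex' Ex; rewrite [x + _]addrC subrK; lra.
Qed.

(** The iterates of a point of [E] along the prefixes stay in the decreasing
    compact cylinders, hence accumulate at a common point of all of them. *)
Lemma coding_cyl i n : cyl (trunc i n) (pi i).
Proof.
have [x0 Ex0] : E !=set0 by case: hE.
pose s n := wmap (trunc i n) x0.
have Es : (s @ \oo) E by exists 0%N => // k _; exact: word_map_E.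
have [x [Ex cx]] := E_compact (fmap_proper_filter _ _) Es.
suff h k : cyl (trunc i k) x by rewrite (coding_unique h).
apply: (@cyl_closed (trunc i k)) => B Bx.
have hs : (s @ \oo) (cyl (trunc i k)).
  by exists k => // l /= kl; apply: cyl_trunc_mono kl _; exists x0.
exact: cx hs Bx.
Qed.

Lemma coding_E i : E (pi i). Proof. exact: cyl_sub_E (coding_cyl i 0). Qed.

Lemma coding_shift i n : pi i = wmap (trunc i n) (pi (shift n i)).
Proof.
apply: coding_unique => k.
apply: (@cyl_trunc_mono i k (n + k)); first exact: leq_addl.
rewrite trunc_add; have [x Ex e] := coding_cyl (shift n i) k.
by exists x => //; rewrite word_map_cat e.
Qed.

Lemma coding_catw w i : pi (catw w i) = wmap w (pi i).
Proof. by rewrite (coding_shift _ (size w)) trunc_catw shift_catw. Qed.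

(** Each point lies in some first-level piece, whose preimage lies again in
    [E]; the letters are chosen by iterating. *)
Lemma coding_surj x : E x -> exists i, pi i = x.
Proof.
move=> Ex.
have step (z : {z | E z}) : exists az : I * {z | E z},
    sval z = aff_map A b az.1 (sval az.2).
  case: z => z Ez /=; move: (Ez); case: (hE) => _ _ {1}-> [a _ [y Ey <-]].
  by exists (a, exist _ y Ey).
pose nx z := sval (cid (step z)).
have nxP z : sval z = aff_map A b (nx z).1 (sval (nx z).2) by exact: svalP (cid (step z)).
pose z n := iter n (fun z => (nx z).2) (exist _ x Ex).
exists (fun n => (nx (z n)).1); apply: coding_unique => n.
exists (sval (z n)); first exact: svalP.
elim: n => // n IH; rewrite truncS -cats1 word_map_cat -[RHS]IH; congr word_map.
by rewrite [RHS]nxP.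
Qed.

Lemma cyl_image w : pi @` cylinder w = cyl w.
Proof.
rewrite eqEsubset; split.
  by move=> _ [i /= iw <-]; have := coding_cyl i (size w); rewrite iw.
move=> _ [x Ex <-]; have [i <-] := coding_surj Ex.
by exists (catw w i); rewrite /cylinder /= ?trunc_catw// coding_catw.
Qed.

(** Where two codes first differ, their tails point into distinct first-level
    pieces.  All uses of the separation hypothesis on cylinders go through
    this. *)
Lemma coding_sep i j n : trunc i n <> trunc j n -> exists q, [/\ (q < n)%N,
  trunc i q = trunc j q & delta < enorm (pi (shift q i) - pi (shift q j))].
Proof.
move=> /trunc_first_diff[q [qn eq ne]]; exists q; split => //.
rewrite (coding_shift (shift q i) 1) (coding_shift (shift q j) 1) /=.
by apply: sepE; rewrite /= ?addn0 //; [rewrite /shift !addn0|exact: coding_E|exact: coding_E].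
Qed.

Lemma coding_inj : injective pi.
Proof.
move=> i j ij; apply/funext => n.
have [e|/coding_sep] := EM (trunc i n.+1 = trunc j n.+1).
  by move: e; rewrite !truncS => /rcons_inj[].
move=> [q [_ e +]]; rewrite (@word_map_inj (trunc i q) (pi (shift q i)) (pi (shift q j))).
  by rewrite subrr enorm0 => /(lt_trans delta0); rewrite ltxx.
by rewrite [in RHS]e -!coding_shift.
Qed.

End Coding.

(** * Line sections of the attractor are porous *)

Section PorousSlices.
Variables (R : realType) (m : nat).
Local Notation I := ('I_m.+2).
Variables (A : I -> 'M[R]_2) (b : I -> 'cV[R]_2) (E : set 'cV[R]_2).
Variables (rho kappa D delta : R).
Hypothesis H : separated_ifs A b E rho kappa D delta.
Let A_unit := matrix_unit H.
Implicit Types (i j : nat -> I) (w : seq I) (x y : 'cV[R]_2).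

Local Notation mx := (word_mx A).
Local Notation wmap := (word_map A b).
Local Notation cyl := (cyl_set A b E).
Local Notation pi := (coding A b).

Section Line.
Variables (y d : 'cV[R]_2).
Hypothesis d0 : d != 0.

(** On a line of direction [d], the map of the word [w] is a similarity of
    ratio [1 / pullback_len w], measured in units of [d]. *)
Definition pullback_len w : R := enorm (invmx (mx w) *m d).

Lemma pullback_len_gt0 w : 0 < pullback_len w.
Proof.
apply: enorm_gt0; apply: contra d0 => /eqP e.
by rewrite -(mulKVmx (word_mx_unit H w) d) e mulmx0.
Qed.

Lemma pullback_dist w x x' s s' :
  wmap w x = y + s *: d -> wmap w x' = y + s' *: d ->
  enorm (x - x') = `|s - s'| * pullback_len w.
Proof.
move=> e e'; rewrite -enormZ scalemxAr; congr enorm.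
have h : mx w *m (x - x') = (s - s') *: d.
  by rewrite -(word_mapB A b) e e' scalerBl opprD addrACA subrr add0r.
by rewrite -h mulKmx// (word_mx_unit H).
Qed.

Lemma pullback_len_rcons w a :
  pullback_len (rcons w a) <= kappa * pullback_len w /\
  pullback_len w <= rho * pullback_len (rcons w a).
Proof.
rewrite /pullback_len -cats1 word_mx_cat (_ : mx [:: a] = A a); last first.
  by rewrite /word_mx big_seq1.
set x := invmx (mx w *m A a) *m d.
have -> : invmx (mx w) *m d = A a *m x.
  apply: (can_inj (mulKmx (word_mx_unit H w))).
  rewrite mulKVmx ?(word_mx_unit H)// /x mulmxA mulKVmx// unitmx_mul A_unit.
  by rewrite (word_mx_unit H).
by split; [exact: expand_le H _ _|exact: contr_le H _ _].
Qed.

Lemma pullback_len_unbounded i (K : R) : exists n, K < pullback_len (trunc i n).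
Proof.
have rho0 := contr_gt0 H.
have h n : pullback_len (trunc i 0) <= rho ^+ n * pullback_len (trunc i n).
  elim: n => [|n IH]; first by rewrite expr0 mul1r.
  apply: le_trans IH _; rewrite exprSr -mulrA ler_wpM2l ?exprn_ge0 ?(ltW rho0)//.
  by rewrite truncS; case: (pullback_len_rcons (trunc i n) (i n)).
have l0 := pullback_len_gt0 (trunc i 0).
have [n _ hn] := rho_small H (`|K| + 1) l0.
exists n; have := h n; have := hn n (leqnn n) => h1 h2.
have {h1 h2} := lt_le_trans h1 h2.
rewrite ltr_pM2l ?exprn_gt0// => /(lt_trans _); apply.
by rewrite (le_lt_trans (ler_norm K))// ltrDl.
Qed.

Lemma pullback_len_mono i n k : (n <= k)%N ->
  pullback_len (trunc i n) <= pullback_len (trunc i k).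
Proof.
move=> /subnKC <-; elim: (k - n)%N => [|l IH]; first by rewrite addn0.
apply: le_trans IH _; rewrite addnS truncS.
have [_ h] := pullback_len_rcons (trunc i (n + l)) (i (n + l)%N).
apply: le_trans h _; rewrite ler_piMl ?(ltW (pullback_len_gt0 _)) ?(ltW (contr_lt1 H))//.
Qed.

(** Take [n] so that the piece of the section in the [n]-th cylinder about the
    given point has length comparable with [r].  Just above the top of that
    piece there is a hole: any point of the section there is outside the
    cylinder, hence branches off at an earlier level, where the gap is at least
    [delta / pullback_len]. *)
Lemma porous_line_section (C : set R) : (forall s, C s -> E (y + s *: d)) -> porous C.
Proof.
move=> CE.
have D0 := diam_gt0 H; have delta0 := gap_gt0 H.
have kap0 : 0 < kappa := kappa0 H.
pose a : R := Num.min (8^-1) (delta / (8 * D * kappa)).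
have a0 : 0 < a by rewrite lt_min invr_gt0 ltr0n/= divr_gt0// !mulr_gt0.
have a8 : a <= 8^-1 by rewrite ge_min lexx.
have ad : a * (8 * D * kappa) <= delta.
  by rewrite -ler_pdivlMr ?mulr_gt0// ge_min lexx orbT.
exists a; split; first by rewrite a0 (le_trans a8)// invf_le1 ?ler1n.
move=> c r Cc r0 _.
have [i ei] := coding_surj H (CE _ Cc).
pose L n := pullback_len (trunc i n).
have L0 n : 0 < L n := pullback_len_gt0 _.
(* [inn]: the piece in a cylinder is short; [out]: the rest is far from it. *)
have inn s n : cyl (trunc i n) (y + s *: d) -> `|s - c| * L n <= D.
  move=> [x Ex e]; have := coding_shift H i n; rewrite ei => /esym e'.
  by rewrite -(pullback_dist e e'); apply: (diam_le H) => //; exact: (coding_E H).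
have out s s' n : cyl (trunc i n) (y + s *: d) -> E (y + s' *: d) ->
    ~ cyl (trunc i n) (y + s' *: d) -> delta < `|s - s'| * L n.
  move=> [x Ex e] Es' ns'.
  have [j ej] := coding_surj H Es'.
  have [k ek] := coding_surj H Ex.
  have ek' : pi (catw (trunc i n) k) = y + s *: d.
    by rewrite (coding_catw H) ek.
  have tk : trunc (catw (trunc i n) k) n = trunc i n.
    by have := trunc_catw (trunc i n) k; rewrite size_trunc.
  have : trunc (catw (trunc i n) k) n <> trunc j n.
    move=> et; apply: ns'; rewrite -ej -tk et; exact: (coding_cyl H).
  move=> /(coding_sep H)[q [qn eq]] /lt_le_trans; apply.
  rewrite (@pullback_dist (trunc j q) _ _ s s').
  - rewrite ler_wpM2l// -eq -[trunc _ q](take_trunc _ (ltnW qn)) tk take_trunc ?(ltnW qn)//.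
    exact/pullback_len_mono/ltnW.
  - by rewrite -eq -(coding_shift H).
  - by rewrite -(coding_shift H).
(* The least [n] whose piece fits in half of the window; for [n = 0] the whole
   section fits, and there is no earlier level to compare with. *)
have [n [nr nn]] : exists n, D / L n <= r / 2 /\
    (n = 0%N \/ delta / L n >= 8 * a * r / 2).
  have ex : exists n, D / L n <= r / 2.
    have [n hn] := pullback_len_unbounded i (D / (r / 2)).
    exists n; rewrite ler_pdivrMr ?L0// mulrC -ler_pdivrMr ?divr_gt0//.
    exact: ltW.
  case: (ex_minnP ex) => n nr nmin; exists n; split => //.
  case: n nr nmin => [|n] nr nmin; [by left|right].
  have : r / 2 < D / L n.
    by rewrite ltNge; apply/negP => /nmin; rewrite ltnn.
  rewrite ltr_pdivlMr ?L0// => h1; rewrite ler_pdivlMr ?L0//.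
  have : L n.+1 <= kappa * L n.
    by rewrite /L truncS; case: (pullback_len_rcons (trunc i n) (i n)).
  move=> h2; apply: le_trans ad.
  have -> : 8 * a * r / 2 * L n.+1 = 8 * a * (r / 2 * L n.+1) by ring.
  have -> : a * (8 * D * kappa) = 8 * a * (kappa * D) by ring.
  rewrite ler_wpM2l ?mulr_ge0 ?(ltW a0)//.
  apply: le_trans (_ : r / 2 * (kappa * L n) <= _).
    by rewrite ler_wpM2l// divr_ge0// ltW.
  by rewrite mulrCA; apply: ler_wpM2l; rewrite ltW.
pose S : set R := [set s | cyl (trunc i n) (y + s *: d)].
have Sc : S c by rewrite /S/= -ei; exact: (coding_cyl H).
have Sr s : S s -> s <= c + r / 2.
  move=> /inn; rewrite -ler_pdivlMr// => h.
  by have := ler_norm (s - c); have := le_trans h nr; lra.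
have hS : has_sup S by split; [exists c|exists (c + r / 2) => s; exact: Sr].
have c_sup : c <= sup S by apply: ub_le_sup => //; case: hS.
have sup_r : sup S <= c + r / 2 by apply: ge_sup; [exists c|move=> s; exact: Sr].
(* The hole is the middle part of the gap of length [4 * (a * r)] above the
   top [sup S] of the piece. *)
exists (sup S + r * (4 * a / 2)) => t; rewrite /= in_itv/= => /andP[t1 t2].
have t1' : sup S + a * r <= t by move: t1; lra.
have t2' : t <= sup S + 3 * (a * r) by move: t2; lra.
have ar : a * r <= r / 8 by rewrite mulrC ler_wpM2l// ltW.
have ar0 : 0 < a * r by rewrite mulr_gt0.
split; first by rewrite in_itv/=; apply/andP; split; lra.
move=> /CE Et.
have nSt : ~ S t.
  by move=> St; have := ub_le_sup (proj2 hS) St; lra.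
case: nn => [n0|nn].
  by apply: nSt; rewrite /S/= n0; exists (y + t *: d).
suff : sup S <= t - 4 * (a * r) by lra.
apply: ge_sup; first by exists c.
move=> s Ss.
have := out _ _ _ Ss Et nSt.
rewrite -ltr_pdivrMr ?L0// => h.
have st : s <= t by have := ub_le_sup (proj2 hS) Ss; lra.
by move: h nn; rewrite distrC ger0_norm ?subr_ge0//; lra.
Qed.

End Line.
End PorousSlices.

(** * Limits of thin sets that slide along one direction *)

Section Limits.
Variable R : realType.
Implicit Types (u v x y z : 'cV[R]_2).

Lemma hausdorff_near (N : nat -> set 'cV[R]_2) (T : set 'cV[R]_2) :
  (forall k, N k !=set0 /\ N k `<=` cball 0 1) -> T !=set0 -> compact T ->
  (fun k => hausdorff_dist (N k) T) @ \oo --> (0 : R) ->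
  forall e : R, 0 < e -> \forall k \near \oo,
    (forall x, N k x -> exists2 y, T y & enorm (x - y) < e) /\
    (forall y, T y -> exists2 x, N k x & enorm (x - y) < e).
Proof.
move=> hN [y0 Ty0] /compact_enorm_bounded[D D0 hD] + e e0.
move=> /cvgrPdist_lt/(_ _ e0); apply: filterS => k.
rewrite sub0r normrN => /(le_lt_trans (ler_norm _)) hk.
rewrite /hausdorff_dist in hk; move: hk; set S := (X in inf X) => hk.
have [[x0 Nx0] NB] := hN k.
have bd x y : N k x -> T y -> enorm (x - y) <= 1 + (D + enorm y0).
  move=> Nx Ty; apply: le_trans (enormB _ _) _; apply: lerD.
    by have := NB _ Nx; rewrite /cball/= subr0.
  by rewrite -{1}(subrK y0 y); apply: le_trans (enormD _ _) _; rewrite lerD2r hD.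
have Sne : S !=set0.
  exists (1 + (D + enorm y0)); split.
  - by rewrite !addr_ge0// ?enorm_ge0// ltW.
  - by move=> x Nx; exists y0 => //; exact: bd.
  - by move=> y Ty; exists x0 => //; exact: bd.
have [t [t0 h1 h2] te] := inf_lt Sne hk.
by split=> [x /h1[y Ty xy]|y /h2[x Nx xy]]; [exists y|exists x] => //; exact: le_lt_trans te.
Qed.

Definition frame v : 'M[R]_2 := \matrix_(i, j) (if j == 0 then v i 0 else perp v i 0).

Lemma frame_mul v x : frame v *m x = x 0 0 *: v + x 1 0 *: perp v.
Proof. by apply/matrixP => i j; rewrite (ord1 j) !mxE sum_ord2 !mxE /=; ring. Qed.

Lemma frame_e1 v : frame v *m e1 = v.
Proof. by rewrite frame_mul /e1 !mxE/= scale1r scale0r addr0. Qed.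

Lemma frame_rotation v : dot v v = 1 -> rotation (frame v).
Proof.
rewrite dotE => vv; split.
  apply/matrixP => i j; rewrite !mxE sum_ord2 !mxE.
  by have [->|->] := ord2P i; have [->|->] := ord2P j; rewrite /= -?vv; ring.
rewrite (expand_det_row _ 0) sum_ord2 /cofactor !det_mx11 !mxE.
have -> : lift 0 0 = 1 :> 'I_2 by apply/val_inj.
have -> : lift 1 0 = 0 :> 'I_2 by apply/val_inj.
by rewrite -[RHS]vv /= addn0 modn_small// add0n; ring.
Qed.

Lemma dot_frame v x : dot v v = 1 ->
  (dot (frame v *m x) v = x 0 0) * (dot (frame v *m x) (perp v) = x 1 0).
Proof.
move=> vv; rewrite frame_mul !dotDl !dotZl dot_perp_perp dot_perp (dotC (perp v)).
by rewrite dot_perp vv !mulr1 !mulr0 addr0 add0r.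
Qed.

Lemma enorm_frame v x : dot v v = 1 -> enorm (frame v *m x) = enorm x.
Proof.
move=> vv; rewrite /enorm (dot_perp_sqr _ vv) !(dot_frame _ vv) (dotE x x).
by rewrite !expr2.
Qed.

(** An ultrafilter finer than the filter of neighbourhoods of infinity replaces
    the successive extractions of subsequences in [limit_section]. *)
Lemma ultra_fmap (X Y : Type) (f : X -> Y) (U : set_system X) :
  UltraFilter U -> UltraFilter (f @ U).
Proof.
move=> UU; split => [|G GP sG]; first exact: fmap_proper_filter.
apply/seteqP; split => [B GB|]; last exact: sG.
have [//|h] := in_ultra_setVsetC (f @^-1` B) UU.
have GC : G (~` B) by exact: sG.
have G0 : G set0 by rewrite -(setICr B); apply: filterI.
by have := @filter_not_empty _ G GP G0.
Qed.

(** The situation obtained by magnifying: [N k] is described by coordinates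
    along [v] and [perp v], which pull back to [E] through the vectors [p k] and
    [q k] ([N_E]); [p k] tends to 0 because [v] is the stretched direction.
    [N_slide] is what the segment hypothesis and genericity provide. *)
Variables (E : set 'cV[R]_2).
Hypothesis cE : compact E.
Hypothesis porousE : forall y (d : 'cV[R]_2), d != 0 -> forall C : set R,
  (forall s, C s -> E (y + s *: d)) -> porous C.

Variables (v : 'cV[R]_2) (N : nat -> set 'cV[R]_2) (T : set 'cV[R]_2).
Variables (y p q : nat -> 'cV[R]_2) (c0 K : R).
Hypothesis vv : dot v v = 1.
Hypothesis N_ball : forall k, N k !=set0 /\ N k `<=` cball 0 1.
Hypothesis Ey : forall k, E (y k).
Hypothesis p0 : p @ \oo --> (0 : 'cV[R]_2).
Hypothesis c0_gt0 : 0 < c0.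
Hypothesis qK : \forall k \near \oo, c0 <= enorm (q k) <= K.
Hypothesis N_E : \forall k \near \oo, forall z, N k z ->
  E (y k + dot z v *: p k + dot z (perp v) *: q k).
Hypothesis N_slide : forall e : R, 0 < e -> \forall k \near \oo, forall z, N k z ->
  forall s, `|s| <= 1 -> exists z', [/\ dot z' v = s,
    `|dot (z' - z) (perp v)| <= e & (enorm z' <= 1 -> N k z')].
Hypothesis T0 : T !=set0.
Hypothesis cT : compact T.
Hypothesis NT : (fun k => hausdorff_dist (N k) T) @ \oo --> (0 : R).

Let hausd := hausdorff_near N_ball T0 cT NT.

Lemma limit_ball z : T z -> enorm z <= 1.
Proof.
move=> Tz; apply/ler_addgt0Pr => e e0.
have [k [_ /(_ z Tz)[x Nx xz]]] := filter_ex (hausd e0).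
have : enorm x <= 1 by have := (N_ball k).2 _ Nx; rewrite /cball/= subr0.
have := enormD x (z - x); rewrite [x + _]addrC subrK (enormBC z) => h1 h2.
by apply: le_trans h1 _; rewrite lerD// ltW.
Qed.

Let clT : closed T := compact_closed (@norm_hausdorff _ _) cT.

(* For points in the open disc: the point moved in [N k] is still in the disc,
   hence belongs to [N k]. *)
Let slide_lt z z' : T z -> enorm z' < 1 -> dot z' (perp v) = dot z (perp v) -> T z'.
Proof.
move=> Tz z'1 zz'; apply: closed_enorm clT _ => e e0.
pose e' := Num.min e (1 - enorm z') / 3.
have e'0 : 0 < e' by rewrite divr_gt0// lt_min e0 subr_gt0.
have e'e : 3 * e' <= e by rewrite mulrC divfK// ge_min lexx.
have e'1 : 3 * e' <= 1 - enorm z' by rewrite mulrC divfK// ge_min lexx orbT.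
clearbody e'.
have [k [[hd1 hd2] hs]] := filter_ex (filterI (hausd e'0) (N_slide e'0)).
have [x Nx xz] := hd2 _ Tz.
have z'v : `|dot z' v| <= 1.
  apply: le_trans (dot_le_enorm _ _) _.
  by rewrite [X in _ * X]/enorm vv sqrtr1 mulr1 ltW.
have [x' [x'v x'x Nx']] := hs _ Nx _ z'v.
have x'z' : enorm (x' - z') < 2 * e'.
  rewrite (perp_decomp (x' - z') vv) !dotBl x'v subrr scale0r add0r enormZ.
  rewrite enorm_perp [X in _ * X]/enorm vv sqrtr1 mulr1 zz' -dotBl.
  have -> : x' - z = (x' - x) + (x - z) by rewrite addrA subrK.
  rewrite dotDl; apply: le_lt_trans (ler_normD _ _) _.
  have : `|dot (x - z) (perp v)| < e'.
    apply: le_lt_trans xz; apply: le_trans (dot_le_enorm _ _) _.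
    by rewrite enorm_perp [X in _ * X]/enorm vv sqrtr1 mulr1.
  by move: x'x; lra.
have /Nx' /hd1[t Tt x't] : enorm x' <= 1.
  by have := enormD (x' - z') z'; rewrite subrK; lra.
exists t => //.
by have := enorm_triangle x' t z'; rewrite (enormBC t x'); lra.
Qed.

(** Boundary points of the disc are limits of interior points at the same
    height, except at the two poles, where the chord is a single point. *)
Lemma limit_fibred z z' : T z -> enorm z' <= 1 ->
  dot z' (perp v) = dot z (perp v) -> T z'.
Proof.
move=> Tz; rewrite le_eqVlt => /orP[/eqP z'1|]; last by move=> ? ?; exact: slide_lt Tz _ _.
move=> zz'; have z1 := limit_ball Tz.
have [a0|a0] := eqVneq (dot z' v) 0.
  suff -> : z' = z by [].
  have h1 : dot z (perp v) ^+ 2 = 1.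
    have : enorm z' ^+ 2 = 1 by rewrite z'1 expr1n.
    by rewrite enorm_sqr (dot_perp_sqr _ vv) a0 zz' expr0n add0r.
  have h2 : dot z v = 0.
    apply/eqP; rewrite -sqrf_eq0 eq_le sqr_ge0 andbT.
    have := expr_le1 (n := 2) isT (enorm_ge0 z); rewrite z1 => h3.
    have : enorm z ^+ 2 <= 1 by rewrite h3.
    by rewrite enorm_sqr (dot_perp_sqr _ vv) h1; lra.
  by rewrite (perp_decomp z' vv) (perp_decomp z vv) a0 h2 zz'.
apply: closed_enorm clT _ => e e0.
pose s := 1 - Num.min e 1 / 2.
have m0 : 0 < Num.min e 1 by rewrite lt_min e0 ltr01.
have m1 : Num.min e 1 <= 1 by rewrite ge_min lexx orbT.
have m2 : Num.min e 1 <= e by rewrite ge_min lexx.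
pose x := s * dot z' v *: v + dot z' (perp v) *: perp v.
have xv : dot x v = s * dot z' v.
  by rewrite dotDl !dotZl vv (dotC (perp v)) dot_perp; ring.
have xp : dot x (perp v) = dot z' (perp v).
  by rewrite dotDl !dotZl dot_perp_perp vv dot_perp; ring.
have v1 : enorm v = 1 by rewrite /enorm vv sqrtr1.
exists x.
  apply: slide_lt Tz _ _; last by rewrite xp.
  rewrite -(@ltr_pXn2r _ 2%N)// ?nnegrE ?enorm_ge0// expr1n.
  have : enorm z' ^+ 2 = 1 by rewrite z'1 expr1n.
  rewrite !enorm_sqr !(dot_perp_sqr _ vv) xv xp => <-.
  rewrite ltrD2r exprMn gtr_pMl; last by rewrite exprn_even_gt0.
  by rewrite expr_lt1//; rewrite /s; lra.
rewrite (perp_decomp (x - z') vv) !dotBl xv xp subrr scale0r addr0.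
rewrite enormZ v1 mulr1 -[X in _ - X]mul1r -mulrBl normrM.
have h : `|dot z' v| <= 1.
  by apply: le_trans (dot_le_enorm _ _) _; rewrite v1 z'1 mulr1.
apply: le_lt_trans (_ : Num.min e 1 / 2 * 1 < _); last by lra.
apply: ler_pM => //.
by rewrite ler_norml; apply/andP; split; rewrite /s; lra.
Qed.

Let C : set R := [set dot z (perp v) | z in T].

(* The coordinate along [v] disappears from the pull-back to [E] because [p]
   tends to 0; what remains is a line section of [E]. *)
Let limit_section : exists y' d, d != 0 /\ forall s, C s -> E (y' + s *: d).
Proof.
have [U [UU sU]] := ultraFilterLemma eventually_filter.
have FU : ProperFilter U by exact: ultra_proper.
have [y' [Ey' cy']] : (E `&` [set x | y @ U --> x]) !=set0.
  have := cE; rewrite compact_ultra; apply; first exact: ultra_fmap.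
  by have : U (y @^-1` E) by apply: filterE => k; exact: Ey.
have lim_entry i : exists r : R, (fun k => q k i 0) @ U --> r.
  have := @segment_compact R (- K) K; rewrite compact_ultra =>
    /(_ _ (@ultra_fmap _ _ (fun k => q k i 0) U UU)).
  case.
    apply: sU; move: qK; apply: filterS => k /andP[_ h].
    rewrite /= in_itv/= -ler_norml; exact: le_trans (enorm_entry _ _) h.
  by move=> r [_ h]; exists r.
have [r0 hr0] := lim_entry 0; have [r1 hr1] := lim_entry 1.
pose d : 'cV[R]_2 := \col_i (if i == 0 then r0 else r1).
have qd : q @ U --> d.
  apply/enorm_cvgP => e e0.
  have e20 : 0 < e / 2 by rewrite divr_gt0.
  move/cvgrPdist_lt : hr0 => /(_ _ e20) h0; move/cvgrPdist_lt : hr1 => /(_ _ e20) h1.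
  apply: filterS2 h0 h1 => k h0 h1; apply: le_lt_trans (enorm_le_entries _) _.
  by rewrite !mxE/= distrC (distrC (q k 1 0)); lra.
exists y', d; split.
  have dn : c0 <= enorm d.
    rewrite leNgt; apply/negP => dc.
    have e0 : 0 < c0 - enorm d by rewrite subr_gt0.
    move/enorm_cvgP : qd => /(_ _ e0) h.
    have [k [/andP[h1 _] h2]] := filter_ex (filterI (sU _ qK) h).
    by have := enormD (q k - d) d; rewrite subrK; lra.
  by apply: contraTneq dn => ->; rewrite enorm0 -ltNge.
move=> _ [z Tz <-]; set c := dot z (perp v).
apply: (closed_enorm (compact_closed (@norm_hausdorff _ _) cE)) => e e0.
have K0 : 0 <= K.
  have [k /andP[_]] := filter_ex qK; exact: le_trans (enorm_ge0 _).
have c1 : `|c| <= 1.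
  apply: le_trans (dot_le_enorm _ _) _.
  by rewrite enorm_perp [X in _ * X]/enorm vv sqrtr1 mulr1 limit_ball.
pose e' := e / (4 + K).
have e'0 : 0 < e' by rewrite divr_gt0// ltr_pwDl.
have e'e : (4 + K) * e' = e by rewrite mulrC divfK// gt_eqF// ltr_pwDl.
clearbody e'.
move/enorm_cvgP : qd => /(_ _ e'0) hq.
move/(@enorm_cvgP R _ U) : cy' => /(_ _ e'0) hy.
move/enorm_cvgP : p0 => /(_ _ e'0) /sU hp.
have [k [[[h1 h2] [h3 /andP[_ h4]]] [[_ h5] h6]]] := filter_ex (filterI
  (filterI (filterI hq hy) (filterI hp (sU _ qK)))
  (filterI (sU _ (hausd e'0)) (sU _ N_E))).
have [x Nx xz] := h5 _ Tz.
exists (y k + dot x v *: p k + dot x (perp v) *: q k); first exact: h6.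
have -> : y k + dot x v *: p k + dot x (perp v) *: q k - (y' + c *: d) =
    (y k - y') + dot x v *: (p k - 0) + dot (x - z) (perp v) *: q k
    + c *: (q k - d).
  rewrite dotBl -/c; apply: cV2P; rewrite !mxE; ring.
have xv : `|dot x v| <= 1.
  apply: le_trans (dot_le_enorm _ _) _.
  rewrite [X in _ * X]/enorm vv sqrtr1 mulr1.
  by have := (N_ball k).2 _ Nx; rewrite /cball/= subr0.
have xzp : `|dot (x - z) (perp v)| <= e'.
  apply: le_trans (dot_le_enorm _ _) _.
  by rewrite enorm_perp [X in _ * X]/enorm vv sqrtr1 mulr1 ltW.
have g1 : enorm (dot x v *: (p k - 0)) <= 1 * e'.
  by rewrite enormZ ler_pM ?enorm_ge0// ltW.
have g2 : enorm (dot (x - z) (perp v) *: q k) <= e' * K.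
  by rewrite enormZ ler_pM ?enorm_ge0.
have g3 : enorm (c *: (q k - d)) <= 1 * e'.
  by rewrite enormZ ler_pM ?enorm_ge0// ltW.
apply: le_lt_trans (enormD _ _) _.
apply: le_lt_trans (lerD (enormD _ _) (lexx _)) _.
apply: le_lt_trans (lerD (lerD (enormD _ _) (lexx _)) (lexx _)) _.
by rewrite -e'e; lra.
Qed.

Lemma limit_shape : exists C' : set R, [/\ closed C', porous C' &
  T = mulmx (frame v) @` (plane_prod setT C' `&` cball 0 1)].
Proof.
exists C; split.
- apply: (compact_closed (@Rhausdorff R)); apply: continuous_compact cT.
  apply: continuous_subspaceT => z.
  exact: (@dot_cvg R _ (nbhs z) (nbhs_filter z) id (fun=> perp v) z (perp v)
    (@cvg_id _ _) (cvg_cst _)).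
- by have [y' [d [d0 h]]] := limit_section; exact: porousE d0 _ h.
- apply/seteqP; split=> [z Tz|_ [w [[_ [z Tz zw]] wB] <-]].
    exists (\col_i (if i == 0 then dot z v else dot z (perp v))).
      split; first by split => //=; rewrite mxE/=; exists z.
      rewrite /cball/= subr0 -(enorm_frame _ vv) frame_mul !mxE/= -(perp_decomp _ vv).
      exact: limit_ball.
    by rewrite frame_mul !mxE/= -(perp_decomp _ vv).
  apply: limit_fibred Tz _ _; last by rewrite (dot_frame _ vv) zw.
  by rewrite (enorm_frame _ vv); move: wB; rewrite /cball/= subr0.
Qed.

End Limits.

(** * Shadows that are segments *)

Section ProjectedSegments.
Variable R : realType.

Lemma segment_projection_between (v : 'cV[R]_2) (S : set 'cV[R]_2) x1 x2 (r : R) :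
  dot v v = 1 -> line_segment (proj_line v @` S) -> S x1 -> S x2 ->
  dot x1 v <= r <= dot x2 v -> exists2 x, S x & dot x v = r.
Proof.
move=> vv [u [u' [_ e]]] Sx1 Sx2 /andP[r1 r2].
have par x : S x -> exists2 t, 0 <= t <= 1 & dot x v = dot u v + t * dot (u' - u) v.
  move=> Sx; have : (proj_line v @` S) (proj_line v x) by exists x.
  rewrite e => -[t /=]; rewrite in_itv/= => t01 /(congr1 (fun z : 'cV[R]_2 => dot z v)).
  by rewrite /proj_line dotDl !dotZl vv divr1 mulr1 => <-; exists t.
have parV t : 0 <= t <= 1 -> exists2 x, S x & dot x v = dot u v + t * dot (u' - u) v.
  move=> t01; have : [set u + t *: (u' - u) | t in `[0, 1]] (u + t *: (u' - u)).
    by exists t => //=; rewrite in_itv.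
  rewrite -e => -[x Sx /(congr1 (fun z : 'cV[R]_2 => dot z v))].
  by rewrite /proj_line dotDl !dotZl vv divr1 mulr1 => <-; exists x.
have [t1 t1i e1] := par _ Sx1; have [t2 t2i e2] := par _ Sx2.
have [r12|r12] := eqVneq (dot x1 v) (dot x2 v).
  by exists x1 => //; apply/eqP; rewrite eq_le r1 r12 r2.
have r12' : 0 < dot x2 v - dot x1 v.
  by rewrite subr_gt0 lt_neqAle r12 (le_trans r1).
pose l := (r - dot x1 v) / (dot x2 v - dot x1 v).
have l0 : 0 <= l by rewrite divr_ge0 ?subr_ge0// ltW// -subr_gt0.
have l1 : l <= 1 by rewrite ler_pdivrMr// mul1r lerD2r.
have [|x Sx ex] := parV ((1 - l) * t1 + l * t2).
  by case/andP: t1i => ? ?; case/andP: t2i => ? ?; nra.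
exists x => //; rewrite ex.
have el : l * (dot x2 v - dot x1 v) = r - dot x1 v by rewrite divfK// gt_eqF.
transitivity (dot x1 v + l * (dot x2 v - dot x1 v)); last by rewrite el; ring.
by rewrite e1 e2; ring.
Qed.

Lemma half_le_mul (a M k : R) : 0 <= a -> 0 <= M -> 1/2 <= k -> a * M <= 2 * M * a * k.
Proof.
move=> a0 M0 hk; have : 0 <= 2 * M * a * (k - 1/2).
  by rewrite !mulr_ge0// subr_ge0.
lra.
Qed.

Lemma quarter_add (a c : R) : a < c / 4 -> a + 2 * (c / 8) <= c / 2.
Proof. by lra. Qed.

(** The numerical core of [edge] below: [Y] is the position of a point relative
    to the window, [F] the magnified position, [r] the contribution of the
    contracted direction. *)
Lemma slab_bound (t c d X Y r F : R) : 0 < t -> 0 < c -> t + d <= c * X -> `|r| <= d ->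
  F * t = c * Y + r -> (F <= 1 -> Y <= X) /\ (- 1 <= F -> - X <= Y).
Proof.
move=> t0 c0 tX; rewrite ler_norml => /andP[r1 r2] e.
split=> h; rewrite -(ler_pM2l c0); have := ler_wpM2r (ltW t0) h;
  by rewrite e ?mulrN; lra.
Qed.

End ProjectedSegments.

(** * Tangent sets at a generic point *)

Section GenericPoint.
Variables (R : realType) (m : nat).
Local Notation I := ('I_m.+2).
Variables (A : I -> 'M[R]_2) (b : I -> 'cV[R]_2) (E : set 'cV[R]_2).
Variables (rho kappa D delta : R).
Hypothesis H : separated_ifs A b E rho kappa D delta.
Variables (alpha : 'I_2 -> seq I -> R) (eta : 'I_2 -> seq I -> 'cV[R]_2).
Hypothesis hsv : forall w, singular_system (word_mx A w) (alpha^~ w) (eta^~ w).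

Local Notation mx := (word_mx A).
Local Notation wmap := (word_map A b).
Local Notation cyl := (cyl_set A b E).
Local Notation pi := (coding A b).

Let rho0 := contr_gt0 H.
Let D0 := diam_gt0 H.
Let delta0 := gap_gt0 H.
Let kap0 : 0 < kappa := kappa0 H.

(** The lower end of a shadow is, up to sign, the endpoint for [- f]. *)
Definition endpoint (w : seq I) (f : 'cV[R]_2) : R := sup [set dot u f | u in cyl w].

(** The tail of the code keeps away from the ends of the shadow of every
    cylinder, at a distance much larger than the width [alpha 1 / alpha 0] of
    the strip seen at the corresponding scale.  The sign [sg] covers both ends
    of the shadow. *)
Definition generic (i : nat -> I) := forall (w : seq I) (sg : bool) (C : R),
  \forall n \near \oo,
    C * (alpha 1 (trunc i n) / alpha 0 (trunc i n)) <
    `|dot (pi (shift n i)) ((-1) ^+ sg *: eta 0 (trunc i n))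
      - endpoint w ((-1) ^+ sg *: eta 0 (trunc i n))|.

Variables (i : nat -> I) (v : 'cV[R]_2) (sgn : nat -> bool).
Let a k n := alpha k (trunc i n).
Let e k n := eta k (trunc i n).
Let th k n := vtheta A eta k (trunc i n).
Let g n := mx (trunc i n).
Let y n := pi (shift n i).
Let x := pi i.

Hypothesis vv : dot v v = 1.
Hypothesis v_lim : (fun n => (-1) ^+ sgn n *: th 0 n) @ \oo --> v.
Hypothesis v_seg : exists n0 : nat, forall n, (n0 <= n)%N -> forall w : seq I,
  line_segment (proj_line v @` cyl (trunc i n ++ w)).
Hypothesis a_ratio : (fun n => a 1 n / a 0 n) @ \oo --> (0 : R).
Hypothesis gen : generic i.

Let hs n := hsv (trunc i n).
Let a_gt0 k n : 0 < a k n := sv_gt0 (hs n) k.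

Let v1 : enorm v = 1. Proof. by rewrite /enorm vv sqrtr1. Qed.
Let th1 k n : enorm (th k n) = 1.
Proof. by rewrite /enorm (left_singular_orth (hs n)) eqxx sqrtr1. Qed.
Let e_1 k n : enorm (e k n) = 1.
Proof. by rewrite /enorm (sv_orth (hs n)) eqxx sqrtr1. Qed.

(* [v] is a limit of vectors orthogonal to [th 1]. *)
Let dot_v_th1 : forall r : R, 0 < r -> \forall n \near \oo, `|dot v (th 1 n)| < r.
Proof.
move=> r r0; move/enorm_cvgP : v_lim => /(_ _ r0); apply: filterS => n.
have -> : dot v (th 1 n) = - dot ((-1) ^+ sgn n *: th 0 n - v) (th 1 n).
  by rewrite dotBl dotZl (left_singular_orth (hs n)) mulr0 sub0r opprK.
move=> h; rewrite normrN; apply: le_lt_trans h.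
by apply: le_trans (dot_le_enorm _ _) _; rewrite th1 mulr1.
Qed.

Let dot_v_th0 : \forall n \near \oo, 1/2 <= `|dot v (th 0 n)|.
Proof.
have h : (0 : R) < 1/2 by rewrite divr_gt0.
have := dot_v_th1 h; apply: filterS => n hn.
have := @orthonormal_sqr R (th 0 n) (th 1 n) v.
rewrite !(left_singular_orth (hs n)) vv => /(_ erefl erefl erefl).
rewrite -(real_normK (num_real (dot v (th 0 n)))) -(real_normK (num_real (dot v (th 1 n)))).
have := normr_ge0 (dot v (th 0 n)); have := normr_ge0 (dot v (th 1 n)).
by move=> h0 h1 h2; rewrite leNgt; apply/negP => h3; nra.
Qed.

Let dot_vp_th1 : \forall n \near \oo, 1/2 <= `|dot (perp v) (th 1 n)|.
Proof.
have h : (0 : R) < 1/2 by rewrite divr_gt0.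
have := dot_v_th1 h; apply: filterS => n hn.
have := @dot_perp_sqr R v (th 1 n) vv.
rewrite (left_singular_orth (hs n)) eqxx !(dotC (th 1 n)) /=.
rewrite -(real_normK (num_real (dot v (th 1 n)))) -(real_normK (num_real (dot (perp v) (th 1 n)))).
have := normr_ge0 (dot (perp v) (th 1 n)); have := normr_ge0 (dot v (th 1 n)).
by move=> h0 h1 h2; rewrite leNgt; apply/negP => h3; nra.
Qed.

Let a1_step n : a 1 n <= kappa * a 1 n.+1.
Proof.
have : a 1 n.+1 = enorm (g n *m (A (i n) *m e 1 n.+1)).
  rewrite -[LHS](enorm_sv_image (hs n.+1) 1) mulmxA /g {1}truncS -cats1 word_mx_cat.
  by rewrite [mx [:: _]]/word_mx big_seq1.
have := enorm_mulmx_ge (hs n) (A (i n) *m e 1 n.+1).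
have := expand_le H (i n) (e 1 n.+1); rewrite e_1 => h1 h2 ->.
apply: le_trans (ler_wpM2l (ltW kap0) h2).
rewrite mulrCA; apply: ler_peMr => //; exact: ltW (a_gt0 _ _).
Qed.

Let a1_low n : (kappa ^+ n)^-1 <= a 1 n.
Proof.
have := word_mx_exp H (trunc i n) (e 1 n).
rewrite e_1 (enorm_sv_image (hs n)) size_trunc => h.
by rewrite -[leLHS]mul1r ler_pdivrMr ?exprn_gt0// mulrC.
Qed.

Let a1_up n : a 1 n <= rho ^+ n.
Proof.
have := word_mx_contr H (trunc i n) (e 1 n).
by rewrite e_1 (enorm_sv_image (hs n)) size_trunc mulr1.
Qed.

Section Scales.
Variable t : nat -> R.
Hypothesis t0 : forall k, 0 < t k.
Hypothesis tlim : t @ \oo --> (0 : R).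

Let scale_ex k : exists n, delta * a 1 n <= t k.
Proof.
have [n _ /(_ n (leqnn n)) h] := rho_small H delta (t0 k).
by exists n; apply: ltW; apply: le_lt_trans h; rewrite mulrC ler_wpM2r ?(ltW delta0)// a1_up.
Qed.

(** The number of letters of [i] that the magnification [t k] resolves. *)
Definition scale k : nat := ex_minn (scale_ex k).

Let scale_ge k : delta * a 1 (scale k) <= t k.
Proof. by rewrite /scale; case: ex_minnP. Qed.

Let scale_lt k n : (n < scale k)%N -> t k < delta * a 1 n.
Proof.
rewrite /scale; case: ex_minnP => l _ lmin nl.
by rewrite ltNge; apply/negP => /lmin; rewrite leqNgt nl.
Qed.

(* A point outside the cylinder branches off at an index below [scale k], where
   the gap is still wider than [t k]. *)
Let scale_cyl k u : E u -> enorm (u - x) <= t k -> cyl (trunc i (scale k)) u.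
Proof.
move=> /(coding_surj H)[j <-] ux.
have [->|/(coding_sep H)[q [qn eq h]]] := EM (trunc i (scale k) = trunc j (scale k)).
  exact: coding_cyl H _ _.
exfalso; have := scale_lt qn; apply/negP; rewrite -leNgt.
apply: le_trans ux.
rewrite /x enormBC (coding_shift H i q) (coding_shift H j q) -eq word_mapB.
apply: le_trans (enorm_mulmx_ge (hs q) _).
by rewrite mulrC ler_wpM2l ?(ltW (a_gt0 _ _))// ltW.
Qed.

Let scale_oo (P : nat -> Prop) : (\forall n \near \oo, P n) -> \forall k \near \oo, P (scale k).
Proof.
move=> [n1 _ hn1].
have e0 : 0 < delta / kappa ^+ n1 by rewrite divr_gt0// exprn_gt0.
move/cvgrPdist_lt : tlim => /(_ _ e0); apply: filterS => k.
rewrite sub0r normrN gtr0_norm// => tk; apply: hn1 => /=.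
rewrite leqNgt; apply/negP => sn.
have := scale_ge k; rewrite leNgt => /negP; apply; apply: lt_le_trans tk _.
rewrite ler_wpM2l ?(ltW delta0)//; apply: le_trans (a1_low _).
by rewrite lef_pV2 ?posrE ?exprn_gt0// ler_weXn2l ?(expand_ge1 H)// ltnW.
Qed.

Let scale_le : \forall k \near \oo, t k <= kappa * delta * a 1 (scale k).
Proof.
have : \forall n \near \oo, (0 < n)%N by exists 1%N.
move/scale_oo; apply: filterS => k s0.
have /scale_lt/ltW h : ((scale k).-1 < scale k)%N by rewrite prednK.
apply: le_trans h _; rewrite -mulrA (mulrCA kappa) ler_wpM2l ?(ltW delta0)//.
by have := a1_step (scale k).-1; rewrite prednK.
Qed.

Let N k := magnification E x (t k).
Let p k := t k *: (invmx (g (scale k)) *m v).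
Let q k := t k *: (invmx (g (scale k)) *m perp v).

Let g_inv k (z : 'cV[R]_2) : g k *m (invmx (g k) *m z) = z.
Proof. by rewrite mulKVmx// (word_mx_unit H). Qed.

Let N_ball k : N k !=set0 /\ N k `<=` cball 0 1.
Proof.
have Ex : E x := coding_E H i.
split.
  exists ((t k)^-1 *: (x - x)); exists x => //; split => //.
  by rewrite /cball/= subrr enorm0 ltW.
move=> _ [u [Eu ux] <-]; rewrite /cball/= subr0 enormZ gtr0_norm ?invr_gt0//.
by rewrite mulrC ler_pdivrMr// mul1r.
Qed.

Let N_coord k z : N k z -> 
  exists2 u, E u & u = y (scale k) + dot z v *: p k + dot z (perp v) *: q k.
Proof.
move=> [u [Eu ux] <-]; set z' := ((t k)^-1 *: (u - x)).
have [u' Eu' eu'] := scale_cyl Eu ux.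
exists u' => //.
have : t k *: z' = g (scale k) *m (u' - y (scale k)).
  rewrite /z' scalerA mulfV ?gt_eqF// scale1r -eu' /x (coding_shift H i (scale k)).
  by rewrite word_mapB.
move/(congr1 (mulmx (invmx (g (scale k))))); rewrite mulKmx ?(word_mx_unit H)//.
rewrite {1}(perp_decomp z' vv) -scalemxAr mulmxDr -!scalemxAr scalerDr => h.
rewrite -addrA -[u' in LHS](subrK (y (scale k))) -h addrC.
by rewrite /p /q !scalerA !(mulrC (t k)) -!scalerA.
Qed.

Let p_lim : p @ \oo --> (0 : 'cV[R]_2).
Proof.
apply/enorm_cvgP => r r0.
pose s := r / (2 * (kappa * delta)).
have kd0 : 0 < kappa * delta by rewrite mulr_gt0.
have s0 : 0 < s by rewrite divr_gt0// mulr_gt0.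
have sr : kappa * delta * s * 2 = r by rewrite /s; field; rewrite !gt_eqF.
clearbody s.
move/cvgrPdist_lt : a_ratio => /(_ _ s0)/scale_oo h1.
have := scale_oo (dot_v_th1 s0); apply: filterS3 h1 scale_le => k h1 h2 h3.
rewrite subr0 enormZ gtr0_norm//.
have := enorm_preimage_le (hs (scale k)) (invmx (g (scale k)) *m v); rewrite g_inv.
set l := enorm _ => hl.
have a0 := a_gt0 0 (scale k); have a1 := a_gt0 1 (scale k).
have q1 : t k / a 1 (scale k) <= kappa * delta by rewrite ler_pdivrMr.
have q0 : t k / a 0 (scale k) < kappa * delta * s.
  have : t k / a 0 (scale k) = t k / a 1 (scale k) * (a 1 (scale k) / a 0 (scale k)).
    by rewrite mulrA divfK// gt_eqF.
  move=> ->; apply: le_lt_trans (ler_wpM2r _ q1) _.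
    by rewrite divr_ge0// ltW.
  rewrite ltr_pM2l//; move: h1; rewrite sub0r normrN; apply: le_lt_trans.
  exact: ler_norm.
have n0 : `|dot v (th 0 (scale k))| <= 1.
  by apply: le_trans (dot_le_enorm _ _) _; rewrite v1 th1 mulr1.
apply: le_lt_trans (ler_wpM2l (ltW (t0 k)) hl) _.
rewrite mulrDr.
have g0 : t k * (`|dot v (th 0 (scale k))| / a 0 (scale k)) <= t k / a 0 (scale k).
  by rewrite mulrCA ler_piMl// divr_ge0// ltW.
have g1 : t k * (`|dot v (th 1 (scale k))| / a 1 (scale k)) <= kappa * delta * s.
  by rewrite mulrCA mulrC ler_pM// ?divr_ge0// ltW.
apply: le_lt_trans (lerD g0 g1) _.
by move: q0 sr; set c := kappa * delta * s => q0 <-; lra.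
Qed.

Let q_bounds : \forall k \near \oo, delta / 2 <= enorm (q k) <= 2 * (kappa * delta).
Proof.
have := scale_oo dot_vp_th1; apply: filterS2 scale_le => k h1 h2.
rewrite enormZ gtr0_norm//.
have a0 := a_gt0 0 (scale k); have a1 := a_gt0 1 (scale k).
have q1 : t k / a 1 (scale k) <= kappa * delta by rewrite ler_pdivrMr.
have q0 : t k / a 0 (scale k) <= kappa * delta.
  apply: le_trans q1; rewrite ler_wpM2l ?(ltW (t0 k))// lef_pV2 ?posrE//.
  exact: sv_le (hs _).
have n0 j : `|dot (perp v) (th j (scale k))| <= 1.
  by apply: le_trans (dot_le_enorm _ _) _; rewrite enorm_perp v1 th1 mulr1.
apply/andP; split.
  have := enorm_preimage_ge (hs (scale k)) (invmx (g (scale k)) *m perp v).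
  rewrite g_inv => h; apply: le_trans (ler_wpM2l (ltW (t0 k)) h).
  have d1 : delta <= t k / a 1 (scale k) by rewrite ler_pdivlMr// scale_ge.
  rewrite mulrCA mulrC; apply: ler_pM => //; first exact: ltW.
  by move: h2; rewrite div1r.
have := enorm_preimage_le (hs (scale k)) (invmx (g (scale k)) *m perp v).
rewrite g_inv => h; apply: le_trans (ler_wpM2l (ltW (t0 k)) h) _.
rewrite mulrDr.
have g_ j : t k * (`|dot (perp v) (th j (scale k))| / a j (scale k)) <= t k / a j (scale k).
  by rewrite mulrCA ler_piMl// divr_ge0// ltW.
by apply: le_trans (lerD (g_ 0) (g_ 1)) _; lra.
Qed.

Let F k u := dot (g (scale k) *m (u - y (scale k))) v / t k.

Let M : R := kappa * delta + D.
Let M0 : 0 < M. Proof. by rewrite addr_gt0// mulr_gt0. Qed.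

(* If the shadow of a cylinder stays on one side of an end of [-1, 1] while
   reaching into the window, then its end is too close to [y (scale k)].  The
   sign [s] selects the side; [s0] is the sign relating [v] to [th 0]. *)
Let edge k (w : seq I) (s : bool) :
  t k <= kappa * delta * a 1 (scale k) ->
  1/2 <= `|dot v (th 0 (scale k))| ->
  (forall sg : bool, 2 * M * (a 1 (scale k) / a 0 (scale k)) <
    `|dot (y (scale k)) ((-1) ^+ sg *: e 0 (scale k))
      - endpoint w ((-1) ^+ sg *: e 0 (scale k))|) ->
  (forall u, cyl w u -> (-1) ^+ s * F k u <= 1) ->
  ~ exists2 u, cyl w u & - 1 <= (-1) ^+ s * F k u.
Proof.
set n := scale k => tk th_ge hgen Fle [u1 wu1 Fu1].
pose k1 := dot v (th 0 n); pose s0 := k1 < 0.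
have a0 := a_gt0 0 n; have a1 := a_gt0 1 n.
have k1E : k1 = (-1) ^+ s0 * `|k1|.
  rewrite /s0; case: ltrP => h; last by rewrite expr0 mul1r ger0_norm.
  by rewrite expr1 mulN1r ltr0_norm// opprK.
pose f := (-1) ^+ (s (+) s0) *: e 0 n.
have Ey : E (y n) := coding_E H _.
have key u : cyl w u -> exists2 r : R, `|r| <= a 1 n * D &
    (-1) ^+ s * F k u * t k = a 0 n * `|k1| * dot (u - y n) f + r.
  move=> wu; exists ((-1) ^+ s * (a 1 n * dot (u - y n) (e 1 n) * dot v (th 1 n))).
    rewrite !normrM normrX normrN1 expr1n mul1r (gtr0_norm a1) -mulrA.
    rewrite ler_wpM2l ?(ltW a1)// -[leRHS]mulr1; apply: ler_pM => //.
      apply: le_trans (dot_le_enorm _ _) _; rewrite e_1 mulr1.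
      by apply: (diam_le H) => //; exact: (cyl_sub_E H) wu.
    by apply: le_trans (dot_le_enorm _ _) _; rewrite v1 th1 mulr1.
  rewrite -mulrA divfK ?gt_eqF// (dot_mulmx_sv (hs n)) mulrDr; congr (_ + _).
  rewrite -/(th 0 n) -/k1 -/(e 0 n) -/(a 0 n) [in LHS]k1E /f dotZr signr_addb.
  move: ((-1) ^+ s) ((-1) ^+ s0) (`|k1|) (dot _ (e 0 n)) (a 0 n) => c1 c2 c3 c4 c5.
  clear; ring.
pose X := 2 * M * (a 1 n / a 0 n).
have XE : X * a 0 n = 2 * M * a 1 n by rewrite /X -mulrA divfK// gt_eqF.
have bnd : t k + a 1 n * D <= a 1 n * M by rewrite /M mulrDr lerD2r [leRHS]mulrC.
have M2 : 0 <= 2 * M by rewrite mulr_ge0// ltW.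
have X0 : 0 <= X by rewrite /X mulr_ge0// divr_ge0// ltW.
have XM : a 1 n * M <= a 0 n * `|k1| * X.
  by rewrite mulrAC (mulrC (a 0 n)) XE; apply: half_le_mul => //; exact: ltW.
have ak : 0 < a 0 n * `|k1| by rewrite mulr_gt0//; apply: lt_le_trans th_ge; rewrite divr_gt0.
have up u : cyl w u -> dot u f <= dot (y n) f + X.
  move=> wu; have [r r1 hr] := key _ wu.
  have [h _] := slab_bound (t0 k) ak (le_trans bnd XM) r1 hr.
  by rewrite -lerBlDl -dotBl; exact: h (Fle _ wu).
have lo : dot (y n) f - X <= dot u1 f.
  have [r r1 hr] := key _ wu1.
  have [_ h] := slab_bound (t0 k) ak (le_trans bnd XM) r1 hr.
  by rewrite lerBlDr -lerBlDl -lerN2 opprB -dotBl; exact: h Fu1.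
have := hgen (s (+) s0); rewrite -/n -/f; apply/negP; rewrite -leNgt ler_distlC -/X.
have uS : has_ubound [set dot u f | u in cyl w].
  by exists (dot (y n) f + X) => _ [u wu <-]; exact: up.
have s1 : dot u1 f <= endpoint w f by apply: ub_le_sup => //; exists u1.
have s2 : endpoint w f <= dot (y n) f + X.
  by apply: ge_sup; [exists (dot u1 f); exists u1|move=> _ [u wu <-]; exact: up].
by rewrite (le_trans lo s1) s2.
Qed.

Let gen_words L C : \forall n \near \oo, forall (w : L.-tuple I) (sg : bool),
  C * (a 1 n / a 0 n) <
  `|dot (y n) ((-1) ^+ sg *: e 0 n) - endpoint w ((-1) ^+ sg *: e 0 n)|.
Proof.
apply: filter_forall => w; apply: filter_forall => sg; exact: gen.
Qed.

(* Move inside a cylinder so small that its vertical extent is negligible; by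
   [edge] its shadow covers [-1, 1]. *)
Let N_slide r : 0 < r -> \forall k \near \oo, forall z, N k z ->
  forall s : R, `|s| <= 1 -> exists z', [/\ dot z' v = s,
    `|dot (z' - z) (perp v)| <= r & (enorm z' <= 1 -> N k z')].
Proof.
move=> r0.
have rd4 : 0 < r * delta / 4 by rewrite divr_gt0// mulr_gt0.
have rd8 : 0 < r * delta / 8 by rewrite divr_gt0// mulr_gt0.
have [L _ /(_ L (leqnn L)) hL] := rho_small H D rd4.
have hgen := scale_oo (gen_words L (2 * M)).
have [n0 hn0] := v_seg.
have hseg : \forall k \near \oo, (n0 <= scale k)%N.
  by apply: (scale_oo (P := fun n => (n0 <= n)%N)); exists n0.
move/enorm_cvgP : p_lim => /(_ _ rd8) hp.
have [K1 _ hK1] := filterI (filterI (filterI hgen hseg) (filterI hp q_bounds))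
  (filterI scale_le (scale_oo dot_v_th0)).
exists K1 => // k /hK1[[[{}hgen {}hseg] [{}hp /andP[hq _]]] [htk hth]] z Nz s s1.
have [u Eu eu] := N_coord Nz.
have [j ej] := coding_surj H Eu.
pose w := trunc j L.
have sw : size w == L by rewrite size_trunc.
have wu : cyl w u by rewrite -ej; exact: coding_cyl H _ _.
have tk0 := t0 k.
have z_u : z = (t k)^-1 *: (g (scale k) *m (u - y (scale k))).
  have -> : u - y (scale k) = dot z v *: p k + dot z (perp v) *: q k.
    by apply/eqP; rewrite subr_eq eu -addrA addrC.
  rewrite mulmxDr -!scalemxAr !g_inv.
  rewrite scalerDr !scalerA !(mulrCA (t k)^-1) mulVf ?gt_eqF// !mulr1.
  exact: perp_decomp.
have Fz : F k u = dot z v by rewrite z_u dotZl /F mulrC.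
have z1 : `|dot z v| <= 1.
  apply: le_trans (dot_le_enorm _ _) _; rewrite v1 mulr1.
  by have := (N_ball k).2 _ Nz; rewrite /cball/= subr0.
have hgen' sg := hgen (Tuple sw) sg.
have ex_le : exists2 u1, cyl w u1 & F k u1 <= s.
  apply: contrapT => hno; apply: (edge (s := true) htk hth hgen').
    move=> u1 wu1; rewrite expr1 mulN1r lerNl.
    rewrite leNgt; apply/negP => h; apply: hno; exists u1 => //.
    by move: s1; rewrite ler_norml => /andP[s1 _]; rewrite ltW// (lt_le_trans h).
  by exists u => //; rewrite expr1 mulN1r lerN2 Fz; move: z1; rewrite ler_norml => /andP[].
have ex_ge : exists2 u2, cyl w u2 & s <= F k u2.
  apply: contrapT => hno; apply: (edge (s := false) htk hth hgen').
    move=> u1 wu1; rewrite expr0 mul1r.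
    rewrite leNgt; apply/negP => h; apply: hno; exists u1 => //.
    by move: s1; rewrite ler_norml => /andP[_ s1]; rewrite ltW// (le_lt_trans s1).
  by exists u => //; rewrite expr0 mul1r Fz; move: z1; rewrite ler_norml => /andP[].
have [u' wu' Fu'] : exists2 u', cyl w u' & F k u' = s.
  have [u1 wu1 h1] := ex_le; have [u2 wu2 h2] := ex_ge.
  pose wm := wmap (trunc i (scale k)).
  have wmE u3 : dot (wm u3) v = F k u3 * t k + dot x v.
    rewrite /F divfK ?gt_eqF// /x (coding_shift H i (scale k)) -(word_mapB A b).
    by rewrite dotBl subrK.
  have cw u3 : cyl w u3 -> cyl (trunc i (scale k) ++ w) (wm u3).
    by move=> [u4 Eu4 <-]; exists u4 => //; rewrite word_map_cat.
  have [|_ [u4 Eu4 <-] +] := segment_projection_between (r := s * t k + dot x v)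
    vv (hn0 _ hseg w) (cw _ wu1) (cw _ wu2).
    by rewrite !wmE !lerD2r !ler_pM2r// h1.
  rewrite word_map_cat -/(wm _) wmE => /addIr/(mulIf (lt0r_neq0 tk0)) h.
  by exists (wmap w u4) => //; exists u4.
pose z' := (t k)^-1 *: (g (scale k) *m (u' - y (scale k))).
exists z'; split.
- by rewrite /z' dotZl mulrC.
- have eq1 : u' - u = (s - dot z v) *: p k + dot (z' - z) (perp v) *: q k.
    have -> : u' - u = t k *: (invmx (g (scale k)) *m (z' - z)).
      rewrite /z' z_u -scalerBr -mulmxBr opprB addrA subrK -scalemxAr scalerA.
      by rewrite mulfV ?gt_eqF// scale1r mulKmx// (word_mx_unit H).
    have -> : s - dot z v = dot (z' - z) v by rewrite dotBl /z' dotZl mulrC -Fu'.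
    rewrite {1}(perp_decomp (z' - z) vv) mulmxDr -!scalemxAr scalerDr.
    by rewrite /p /q !scalerA !(mulrC (t k)).
  have d1 : enorm (u' - u) <= rho ^+ L * D.
    by have := cyl_diam H wu' wu; rewrite size_trunc.
  have d2 : enorm ((s - dot z v) *: p k) <= 2 * (r * delta / 8).
    rewrite enormZ; apply: ler_pM => //; first exact: enorm_ge0.
      by apply: le_trans (ler_normB _ _) _; rewrite -[2]/(1 + 1) lerD.
    by apply: ltW; move: hp; rewrite subr0.
  have d3 : enorm (dot (z' - z) (perp v) *: q k) <= r * delta / 2.
    have -> : dot (z' - z) (perp v) *: q k = (u' - u) - (s - dot z v) *: p k.
      by apply/eqP; rewrite eq_sym subr_eq eq1 addrC.
    apply: le_trans (enormB _ _) _; apply: le_trans (lerD d1 d2) _.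
    exact: quarter_add.
  rewrite enormZ in d3.
  have d4 : `|dot (z' - z) (perp v)| * (delta / 2) <= r * (delta / 2).
    by rewrite [leRHS]mulrA; apply: le_trans d3; rewrite ler_wpM2l.
  by rewrite ler_pM2r ?divr_gt0 in d4.
- move=> z'1; exists (wmap (trunc i (scale k)) u').
    split; first by apply: (word_map_E H); exact: cyl_sub_E H _ _ wu'.
    rewrite /cball/= /x (coding_shift H i (scale k)) word_mapB.
    by move: z'1; rewrite /z' enormZ gtr0_norm ?invr_gt0// mulrC ler_pdivrMr// mul1r.
  by rewrite /z' /x (coding_shift H i (scale k)) word_mapB.
Qed.


Lemma magnification_limit_fibred (T : set 'cV[R]_2) : T !=set0 -> compact T ->
  (fun k => hausdorff_dist (magnification E x (t k)) T) @ \oo --> (0 : R) ->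
  exists C : set R, [/\ closed C, porous C &
    T = mulmx (frame v) @` (plane_prod setT C `&` cball 0 1)].
Proof.
move=> T0 cT hT.
apply: (@limit_shape R E (E_compact H) _ v N T (fun k => y (scale k)) p q
  (delta / 2) (2 * (kappa * delta))) => //.
- by move=> y' d d0 C; exact: (porous_line_section H d0).
- by move=> k; exact: coding_E H _.
- by rewrite divr_gt0.
- by apply: nearW => k z /N_coord[u Eu <-].
Qed.

End Scales.

Lemma tangent_set_fibred T : tangent_set E x T ->
  exists C : set R, [/\ closed C, porous C &
    T = mulmx (frame v) @` (plane_prod setT C `&` cball 0 1)].
Proof.
by move=> [T0 cT [t [t0 _ tlim hT]]]; exact: magnification_limit_fibred t0 tlim T T0 cT hT.
Qed.

End GenericPoint.

(** * Averages over words *)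

Section WordSums.
Variables (R : realType) (m : nat).
Local Notation I := ('I_m.+2).
Variable p : I -> R.
Hypothesis p_gt0 : forall a, 0 < p a.
Hypothesis p_sum : \sum_a p a = 1.
Implicit Types (F G : seq I -> R) (w : seq I).

(** The expectation of [F] at a random word of length [n] with independent
    letters of law [p]; the recursive form makes conditioning on a prefix
    ([word_sum_cat]) immediate. *)
Fixpoint word_sum n F : R :=
  if n is n'.+1 then \sum_a p a * word_sum n' (fun w => F (a :: w)) else F [::].

Lemma ler_word_sum n F G : (forall w, size w = n -> F w <= G w) ->
  word_sum n F <= word_sum n G.
Proof.
elim: n F G => [|n IH] F G h /=; first exact: h.
apply: ler_sum => a _; rewrite ler_wpM2l ?(ltW (p_gt0 a))//.
by apply: IH => w sw; apply: h; rewrite /= sw.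
Qed.

Lemma word_sum_cst n c : word_sum n (fun=> c) = c.
Proof. by elim: n => //= n ->; rewrite -mulr_suml p_sum mul1r. Qed.

Lemma word_sumZ n c F : word_sum n (fun w => c * F w) = c * word_sum n F.
Proof.
elim: n F => //= n IH F; rewrite mulr_sumr; apply: eq_bigr => a _.
by rewrite IH mulrCA.
Qed.

Lemma word_sum_cat n k F :
  word_sum (n + k) F = word_sum n (fun w => word_sum k (fun w' => F (w ++ w'))).
Proof.
by elim: n F => //= n IH F; apply: eq_bigr => a _; rewrite IH.
Qed.

Lemma word_sum_neq h :
  word_sum (size h) (fun w => (w != h)%:R) = 1 - \prod_(a <- h) p a.
Proof.
elim: h => [|a h IH] /=; first by rewrite big_nil subrr.
rewrite big_cons (bigD1 a)//= (_ : word_sum _ _ = 1 - \prod_(a <- h) p a); last first.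
  rewrite -IH; congr word_sum; apply/funext => w.
  by rewrite eqseq_cons eqxx.
rewrite (eq_bigr p) => [|a' a'a].
  by rewrite mulrBr mulr1 addrAC; congr (_ - _); rewrite -p_sum [RHS](bigD1 a).
rewrite (_ : (fun w => _) = fun=> 1); first by rewrite word_sum_cst mulr1.
by apply/funext => w; rewrite eqseq_cons (negbTE a'a).
Qed.

Lemma prob_min : exists2 pmin : R, 0 < pmin <= 1 & forall a, pmin <= p a.
Proof.
exists (\big[Num.min/1]_a p a); last by move=> a; apply: bigmin_le_cond.
by rewrite bigmin_le_id andbT; apply: lt_bigmin => // a _.
Qed.

End WordSums.

(** * Bernoulli measure of a condition on a prefix *)

Section CylinderMeasure.
Variables (R : realType) (m : nat).
Local Notation I := ('I_m.+2).
Variables (p : I -> R) (nu : probability (code_space m) R).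
Hypothesis hnu : bernoulli_measure p nu.

Lemma cylinder_measurable (w : seq I) : measurable (cylinder w : set (code_space m)).
Proof. by apply: sub_sigma_algebra; exists w. Qed.

Lemma bernoulli_prefix_le (P : seq I -> Prop) n :
  measurable ([set i | P (trunc i n)] : set (code_space m)) /\
  (nu [set i | P (trunc i n)] <= (word_sum p n (fun w => `[< P w >]%:R))%:E)%E.
Proof.
pose S g n := [set i | trunc i (size g) = g /\ P (trunc i (size g + n))] : set (code_space m).
suff h g : measurable (S g n) /\
    (nu (S g n) <= (\prod_(a <- g) p a * word_sum p n (fun w => `[< P (g ++ w) >]%:R))%:E)%E.
  have [h1 h2] := h [::]; rewrite big_nil mul1r in h2.
  by have <- : S [::] n = [set i | P (trunc i n)] by apply/seteqP; split=> i //= [].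
elim: n g => [|n IH] g.
  rewrite /= cats0; have [Pg|nPg] := asboolP (P g).
    have -> : S g 0%N = cylinder g.
      by apply/seteqP; split=> [i []//|i ig]; split => //; rewrite addn0 ig.
    by rewrite mulr1 (hnu g); split => //; exact: cylinder_measurable.
  have -> : S g 0%N = set0.
    by apply/seteqP; split=> // i [ig]; rewrite addn0 ig.
  by rewrite mulr0 measure0.
have -> : S g n.+1 = \big[setU/set0]_a S (rcons g a) n.
  rewrite -bigcup_seq/=; apply/seteqP; split=> [i [ig Pi]|i [a _ []]].
    exists (i (size g)); rewrite /= ?mem_index_enum//; split.
      by rewrite size_rcons truncS ig.
    by rewrite size_rcons addSnnS.
  rewrite size_rcons truncS => /rcons_inj[ig _]; rewrite addSnnS => Pi.
  by split.
rewrite /= mulr_sumr.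
elim/big_rec2 : _ => [|a r B _ [mB nB]]; first by rewrite measure0.
have [mS nS] := IH (rcons g a); split; first exact: measurableU.
apply: le_trans (measureU2 _ mS mB) _.
rewrite EFinD; apply: leeD => //; apply: le_trans nS _.
rewrite lee_fin -cats1 big_cat big_seq1 mulrA.
by rewrite (_ : (fun w => _) = (fun w => `[< P (g ++ a :: w) >]%:R))//;
  apply/funext => w; rewrite -catA.
Qed.

End CylinderMeasure.

(** * Mass of thin strips *)

Section Strips.
Variables (R : realType) (m : nat).
Local Notation I := ('I_m.+2).
Variables (A : I -> 'M[R]_2) (b : I -> 'cV[R]_2) (E : set 'cV[R]_2).
Variables (rho kappa D delta : R).
Hypothesis H : separated_ifs A b E rho kappa D delta.
Variable p : I -> R.
Hypothesis p_gt0 : forall a, 0 < p a.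
Hypothesis p_sum : \sum_a p a = 1.

Local Notation mx := (word_mx A).
Local Notation wmap := (word_map A b).
Local Notation cyl := (cyl_set A b E).

(** Strips are given by a normal vector [f] that need not be a unit, so that
    they can be pulled back by linear maps. *)
Definition meets_strip w (f : 'cV[R]_2) (c r : R) :=
  exists2 u, cyl w u & `|dot u f - c| <= r.

(** Up to sign, [dot u (perp v)] is the determinant of [u] and [v]. *)
Definition noncollinear := exists x0 x1 x2,
  [/\ E x0, E x1, E x2 & dot (x1 - x0) (perp (x2 - x0)) != 0].

Hypothesis ncol : noncollinear.

(** A strip that comes near three non-collinear points cannot be thin; so it is
    far from one of them, and from the small cylinder about that point. *)
Lemma strip_misses_cylinder : exists N0 (r0 : R), 0 < r0 /\
  forall f c, f != 0 -> exists2 h, size h = N0 &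
    forall u, cyl h u -> r0 * enorm f < `|dot u f - c|.
Proof.
have [x0 [x1 [x2 [E0 E1 E2 det0]]]] := ncol.
have [K K0 hK] := dot_perp_bound det0.
pose r0 : R := (K * 8)^-1 / 2.
have r00 : 0 < r0 by rewrite divr_gt0// invr_gt0 mulr_gt0.
have Kr : K * (8 * r0) = 1/2 by rewrite /r0; field; rewrite gt_eqF.
have [N0 _ /(_ N0 (leqnn _)) hN0] := rho_small H D r00.
exists N0, r0; split => // f c f0.
have fp := enorm_gt0 f0.
have [x Ex xfar] : exists2 x, E x & 2 * r0 * enorm f < `|dot x f - c|.
  apply: contrapT => hno.
  have near x : E x -> `|dot x f - c| <= 2 * r0 * enorm f.
    by move=> Ex; rewrite leNgt; apply/negP => h; apply: hno; exists x.
  have diff x y : E x -> E y -> `|dot (x - y) f| <= 4 * r0 * enorm f.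
    move=> Ex Ey; rewrite dotBl.
    have -> : dot x f - dot y f = (dot x f - c) - (dot y f - c) by ring.
    by apply: le_trans (ler_normB _ _) _; have := near _ Ex; have := near _ Ey; lra.
  have := hK f; apply/negP; rewrite -ltNge.
  apply: le_lt_trans (ler_wpM2l (ltW K0) (lerD (diff _ _ E1 E0) (diff _ _ E2 E0))) _.
  have -> : K * (4 * r0 * enorm f + 4 * r0 * enorm f) = K * (8 * r0) * enorm f by ring.
  by rewrite Kr; lra.
have [i ei] := coding_surj H Ex.
exists (trunc i N0); first exact: size_trunc.
move=> u hu; have := cyl_diam H (coding_cyl H i N0) hu; rewrite ei size_trunc => hxu.
have h1 : `|dot (x - u) f| <= r0 * enorm f.
  apply: le_trans (dot_le_enorm _ _) _; rewrite ler_wpM2r ?enorm_ge0//.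
  by apply: le_trans hxu _; exact: ltW.
have h2 := ler_normB (dot (x - u) f) (c - dot u f).
have e : dot (x - u) f - (c - dot u f) = dot x f - c by rewrite dotBl; ring.
by rewrite e (distrC c) in h2; lra.
Qed.

Lemma enorm_trmx_ge (w : seq I) f : enorm f <= kappa ^+ size w * enorm ((mx w)^T *m f).
Proof.
have [->|f0] := eqVneq f 0; first by rewrite mulmx0 enorm0 mulr0.
have fp := enorm_gt0 f0.
set x := invmx (mx w) *m f.
have ex : mx w *m x = f by rewrite mulKVmx// (word_mx_unit H).
rewrite -(ler_pM2l fp) -expr2 enorm_sqr -{1}ex dot_mulmx.
apply: le_trans (ler_norm _) _; apply: le_trans (dot_le_enorm _ _) _.
rewrite mulrCA mulrA ler_wpM2r ?enorm_ge0//.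
by have := word_mx_exp H w x; rewrite ex.
Qed.

(** Each block of [N0] letters costs a factor [q]: the strip misses one of the
    cylinders of that block, and pulled back to the others it is again a strip,
    at most [kappa ^+ N0] times wider. *)
Lemma strip_mass : exists N0 (r0 q : R), [/\ 0 < r0, 0 <= q < 1 &
  forall k f c r, f != 0 -> 0 <= r -> kappa ^+ (k * N0) * r <= r0 ->
    word_sum p (k * N0) (fun w => `[< meets_strip w f c (r * enorm f) >]%:R) <= q ^+ k].
Proof.
have [N0 [r0 [r00 miss]]] := strip_misses_cylinder.
have [pmin /andP[pm0 pm1] hpm] := prob_min p_gt0.
exists N0, r0, (1 - pmin ^+ N0); split => //.
  by rewrite subr_ge0 exprn_ile1 ?(ltW pm0)//= ltrBlDr ltrDl exprn_gt0.
set q := 1 - _.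
have q0 : 0 <= q by rewrite subr_ge0 exprn_ile1 ?(ltW pm0).
have k1 := expand_ge1 H; have k0 := kappa0 H.
elim=> [|k IH] f c r f0 r_ge0 hr.
  by rewrite mul0n/= expr0; case: asboolP.
have [h sh hmiss] := miss f c f0.
rewrite mulSn word_sum_cat.
apply: (@le_trans _ _ (word_sum p N0 (fun w => q ^+ k * (w != h)%:R))); last first.
  rewrite word_sumZ exprSr ler_wpM2l ?exprn_ge0// -{1}sh word_sum_neq// lerD2l lerN2.
  rewrite -sh; elim: (h) => [|a h' IHh]; first by rewrite big_nil.
  by rewrite big_cons exprS; apply: ler_pM => //; rewrite ?exprn_ge0 ?ltW.
have rr0 : r <= r0.
  by apply: le_trans hr; rewrite ler_peMl// exprn_ege1.
apply: ler_word_sum => // w sw; have [->|wh] := eqVneq w h.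
  rewrite mulr0 -[leRHS](word_sum_cst p_sum (k * N0) 0).
  apply: ler_word_sum => // w' _; case: asboolP => // -[u hu hur].
  have := hmiss _ (cyl_cat_sub H hu); rewrite ltNge => /negP[].
  by apply: le_trans hur _; rewrite ler_wpM2r ?enorm_ge0.
rewrite mulr1; set f' := (mx w)^T *m f.
have ff' : enorm f <= kappa ^+ N0 * enorm f' by rewrite -sw enorm_trmx_ge.
have f'0 : f' != 0.
  apply: contraNneq f0 => e; move: ff'; rewrite e enorm0 mulr0 => h0.
  by apply/eqP/enorm_eq0/eqP; rewrite eq_le h0 enorm_ge0.
apply: le_trans (IH f' (c - dot (wmap w 0) f) (kappa ^+ N0 * r) f'0 _ _).
- apply: ler_word_sum => // w' _; rewrite ler_nat.
  case: asboolP => [[u hu hur]|//]; case: asboolP => // -[].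
  move: hu => [x Ex e]; exists (wmap w' x); first by exists x.
  have -> : dot (wmap w' x) f' - (c - dot (wmap w 0) f) = dot u f - c.
    rewrite -e word_map_cat [in RHS]word_mapE dotDl dot_mulmx; ring.
  apply: le_trans hur _; rewrite (mulrC (kappa ^+ N0)) -mulrA.
  by rewrite ler_wpM2l.
- by rewrite mulr_ge0// exprn_ge0// ltW.
- by rewrite mulrA -exprD addnC -mulSn.
Qed.

End Strips.

(** * A convergent series *)

Section GeometricBlocks.
Variable R : realType.

Lemma bernoulli_ineq (x : R) n : 0 <= x <= 1 -> 1 - n%:R * x <= (1 - x) ^+ n.
Proof.
move=> /andP[x0 x1]; elim: n => [|n IH]; first by rewrite mul0r subr0 expr0.
rewrite exprS; apply: le_trans (ler_wpM2l _ IH); last by rewrite subr_ge0.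
have : 0 <= n%:R * x * x by rewrite !mulr_ge0.
by rewrite -natr1; lra.
Qed.

(** A root of [q], up to rounding upwards; [1 - x] with [L x] at most
    [(1 - q) / 2] is large enough by Bernoulli's inequality. *)
Lemma block_root (q : R) L : (0 < L)%N -> 0 <= q < 1 ->
  exists2 s : R, 0 < s < 1 & q <= s ^+ L.
Proof.
move=> L0 /andP[q0 q1].
have L0' : 0 < L%:R :> R by rewrite ltr0n.
have L1 : 1 <= L%:R :> R by rewrite ler1n.
pose x := (1 - q) / (2 * L%:R).
have x0 : 0 < x by rewrite divr_gt0 ?mulr_gt0// subr_gt0.
have xL : L%:R * x = (1 - q) / 2 by rewrite /x; field; rewrite gt_eqF.
have x2 : x <= 1/2.
  have : 1 * x <= L%:R * x by rewrite ler_wpM2r// ltW.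
  by rewrite mul1r xL; lra.
exists (1 - x); first by apply/andP; split; lra.
apply: le_trans (bernoulli_ineq L (_ : 0 <= x <= 1)); first by rewrite xL; lra.
by apply/andP; split; lra.
Qed.

Lemma geometric_partial_sum (s : R) n : 0 < s < 1 ->
  \sum_(0 <= k < n) s ^+ k <= (1 - s)^-1.
Proof.
move=> /andP[s0 s1].
have e : (1 - s) * \sum_(0 <= k < n) s ^+ k = 1 - s ^+ n.
  elim: n => [|n IH]; first by rewrite big_nil mulr0 expr0 subrr.
  by rewrite big_nat_recr//= mulrDr IH exprS; ring.
rewrite -[leRHS]mulr1 ler_pdivlMl ?subr_gt0// e gerBl exprn_ge0//; exact: ltW.
Qed.

Lemma block_series_fin (q : R) L : (0 < L)%N -> 0 <= q < 1 ->
  (\sum_(n <oo) (q ^+ (n %/ L))%:E < +oo)%E.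
Proof.
move=> L0 q01; have [s /andP[s0 s1] qs] := block_root L0 q01.
have q0 : 0 <= q by case/andP: q01.
have term n : q ^+ (n %/ L) <= s ^+ n / s ^+ L.
  rewrite ler_pdivlMr ?exprn_gt0//.
  apply: le_trans (_ : s ^+ (L * (n %/ L)) * s ^+ L <= _).
    by rewrite ler_wpM2r ?exprn_ge0 ?(ltW s0)// exprM lerXn2r// nnegrE// exprn_ge0// ltW.
  rewrite -exprD ler_wiXn2l ?(ltW s0) ?(ltW s1)//.
  by rewrite {1}(divn_eq n L) mulnC leq_add2l ltnW// ltn_pmod.
apply: (@le_lt_trans _ _ ((1 - s)^-1 / s ^+ L)%:E); last exact: ltry.
apply: lime_le.
  by apply: is_cvg_nneseries => n _ _; rewrite lee_fin exprn_ge0.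
apply: nearW => n; rewrite sumEFin lee_fin.
apply: (@le_trans _ _ (\sum_(0 <= k < n) s ^+ k / s ^+ L)).
  by apply: ler_sum => k _; exact: term.
rewrite -mulr_suml ler_wpM2r ?invr_ge0 ?exprn_ge0 ?(ltW s0)//.
by apply: geometric_partial_sum; rewrite s0.
Qed.

End GeometricBlocks.

(** * Almost every code is generic *)

Section AlmostEverywhere.
Variables (R : realType) (m : nat).
Local Notation I := ('I_m.+2).
Variables (A : I -> 'M[R]_2) (b : I -> 'cV[R]_2) (E : set 'cV[R]_2).
Variables (rho kappa D delta : R).
Hypothesis H : separated_ifs A b E rho kappa D delta.
Variables (alpha : 'I_2 -> seq I -> R) (eta : 'I_2 -> seq I -> 'cV[R]_2).
Hypothesis hsv : forall w, singular_system (word_mx A w) (alpha^~ w) (eta^~ w).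
Variables (p : I -> R) (nu : probability (code_space m) R).
Hypothesis p_gt0 : forall a, 0 < p a.
Hypothesis p_sum : \sum_a p a = 1.
Hypothesis hnu : bernoulli_measure p nu.
Hypothesis ncol : noncollinear E.

Local Notation pi := (coding A b).
Local Notation endpoint := (endpoint A b E).

Let f (sg : bool) (w : seq I) : 'cV[R]_2 := (-1) ^+ sg *: eta 0 w.

Let f1 sg w : enorm (f sg w) = 1.
Proof.
by rewrite enormZ normrX normrN1 expr1n mul1r /enorm (sv_orth (hsv w)) eqxx sqrtr1.
Qed.

(** Borel-Cantelli.  At stage [n] the strip is chosen by the first [n] letters,
    and the point [coding (shift n i)] is tested on its next [n %/ L * N0]
    letters; for any [L] the masses are summable, and large [L] makes the strips
    decay slowly. *)
Lemma strip_avoidance : exists N0 (r0 : R), 0 < r0 /\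
  forall L w sg, (0 < L)%N ->
  {ae nu, forall i : code_space m, \forall n \near \oo,
    r0 / kappa ^+ (n %/ L * N0) <
    `|dot (pi (shift n i)) (f sg (trunc i n)) - endpoint w (f sg (trunc i n))|}.
Proof.
have [N0 [r0 [q [r00 q01 hq]]]] := strip_mass H p_gt0 p_sum ncol.
exists N0, r0; split => // L w sg L0.
have k0 := kappa0 H.
pose r n : R := r0 / kappa ^+ (n %/ L * N0).
have r_gt0 n : 0 < r n by rewrite divr_gt0// exprn_gt0.
pose P n (u : seq I) := meets_strip A b E (drop n u) (f sg (take n u))
  (endpoint w (f sg (take n u))) (r n * enorm (f sg (take n u))).
pose G n : set (code_space m) := [set i | P n (trunc i (n + n %/ L * N0))].
have mG n : measurable (G n) := (bernoulli_prefix_le hnu (P n) _).1.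
have nG n : (nu (G n) <= (q ^+ (n %/ L))%:E)%E.
  apply: le_trans (bernoulli_prefix_le hnu (P n) _).2 _.
  rewrite lee_fin word_sum_cat -[leRHS](word_sum_cst p_sum n).
  apply: (ler_word_sum p_gt0) => u su.
  have -> : (fun w' => `[<P n (u ++ w')>]%:R : R) =
      (fun w' => `[< meets_strip A b E w' (f sg u) (endpoint w (f sg u))
         (r n * enorm (f sg u)) >]%:R).
    by apply/funext => w'; rewrite /P drop_size_cat// take_size_cat.
  apply: hq.
  - by apply: contra_eq_neq (f1 sg u) => ->; rewrite enorm0 eq_sym oner_neq0.
  - exact: ltW.
  - by rewrite /r mulrCA divff ?mulr1// expf_neq0// gt_eqF.
exists (lim_sup_set G); split.
- by apply: bigcapT_measurable => n; apply: bigcup_measurable => k _; exact: mG.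
- apply: lim_sup_set_cvg0 => //; apply: le_lt_trans (block_series_fin L0 q01).
  by apply: lee_nneseries => // n _; exact: nG.
- move=> i /= hi n _; apply: contrapT => hno; apply: hi; exists n => // k nk.
  rewrite /= ltNge; apply/negP => hk; apply: hno; exists k => //.
  rewrite /G /P /= take_trunc ?leq_addr// trunc_add drop_size_cat ?size_trunc//.
  exists (pi (shift k i)); first exact: coding_cyl H _ _.
  by rewrite f1 mulr1.
Qed.

Variable lambda : 'I_2 -> R.
Hypothesis hlambda : lyapunov_exponents nu alpha lambda.
Hypothesis gap : lambda 0 < lambda 1.

Let c : R := (lambda 1 - lambda 0) / 4.

(** A quarter of the gap is given up for each of the two exponents. *)
Lemma ratio_decay : {ae nu, forall i : code_space m, \forall n \near \oo,
  alpha 1 (trunc i n) / alpha 0 (trunc i n) <= expR (- (2 * c)) ^+ n}.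
Proof.
have c0 : 0 < c by rewrite divr_gt0// subr_gt0.
have h0 := hlambda 0; have h1 := hlambda 1.
apply: filterS2 h0 h1 => i.
move/cvgrPdist_lt => /(_ _ c0) h0; move/cvgrPdist_lt => /(_ _ c0) h1.
have n0 : \forall n \near \oo, (0 < n)%N by exists 1%N.
apply: filterS3 n0 h0 h1 => n n0 h0 h1.
have a0 := sv_gt0 (hsv (trunc i n)) 0; have a1 := sv_gt0 (hsv (trunc i n)) 1.
rewrite -ler_ln ?posrE ?divr_gt0 ?exprn_gt0 ?expR_gt0// ln_div ?posrE//.
rewrite -expRM_natl expRK.
have n0' : 0 < n%:R :> R by rewrite ltr0n.
rewrite -(ler_pM2l (_ : 0 < n%:R^-1)) ?invr_gt0//.
rewrite mulrA mulVf ?gt_eqF// mul1r mulrBr.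
move: h0 h1; rewrite !ltr_norml => /andP[l1 l2] /andP[l3 l4].
have : lambda 1 - lambda 0 = 4 * c by rewrite /c; field.
by move: l1 l2 l3 l4; set x := _^-1 * _; set y := _^-1 * _; lra.
Qed.

(** [L] is taken so large that the strips of [strip_avoidance] shrink more
    slowly than the ratio [alpha 1 / alpha 0]. *)
Lemma generic_ae : {ae nu, forall i : code_space m,
  generic A b E alpha eta i /\
  (fun n => alpha 1 (trunc i n) / alpha 0 (trunc i n)) @ \oo --> (0 : R)}.
Proof.
have c0 : 0 < c by rewrite divr_gt0// subr_gt0.
have k0 := kappa0 H; have k1 := expand_ge1 H.
have [N0 [r0 [r00 avoid]]] := strip_avoidance.
set th := expR (- c).
have th0 : 0 < th := expR_gt0 _.
have th1 : th < 1 by rewrite -expR0 ltr_expR oppr_lt0.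
have small (e C : R) : 0 < e -> \forall n \near \oo, th ^+ n * C < e.
  by apply: expr_small; rewrite th0.
have kN0 : 0 < kappa ^- N0 by rewrite invr_gt0 exprn_gt0.
have [L [L0 hL]] : exists L, (0 < L)%N /\ th ^+ L <= kappa ^- N0.
  have [L0 _ hL0] := small _ 1 kN0.
  by exists L0.+1; split => //; apply: ltW; have := hL0 L0.+1 (leqnSn _); rewrite mulr1.
have avoid' : {ae nu, forall i : code_space m, forall w sg, \forall n \near \oo,
    r0 / kappa ^+ (n %/ L * N0) <
    `|dot (pi (shift n i)) (f sg (trunc i n)) - endpoint w (f sg (trunc i n))|}.
  have : {ae nu, forall i : code_space m, forall k : nat,
      if unpickle k is Some wsg then \forall n \near \oo,
        r0 / kappa ^+ (n %/ L * N0) <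
        `|dot (pi (shift n i)) (f wsg.2 (trunc i n)) - endpoint wsg.1 (f wsg.2 (trunc i n))|
      else True}.
    apply: ae_foralln => k; case: unpickle => [[w sg]|]; last exact: aeW.
    exact: avoid.
  apply: filterS => i h w sg; have := h (pickle (w, sg)).
  by rewrite pickleK.
apply: filterS2 avoid' ratio_decay => i av dec.
have th2 : expR (- (2 * c)) = th * th by rewrite /th -expRD; congr expR; ring.
rewrite th2 in dec.
have apos n k : 0 < alpha k (trunc i n) := sv_gt0 (hsv (trunc i n)) k.
split; last first.
  apply/cvgrPdist_lt => e e0.
  have := small e 1 e0; apply: filterS2 dec => n h1 h2.
  rewrite sub0r normrN gtr0_norm ?divr_gt0//; apply: le_lt_trans h1 _.
  apply: le_lt_trans h2; rewrite mulr1 lerXn2r// ?nnegrE ?mulr_ge0 ?(ltW th0)//.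
  by rewrite ler_piMl// ltW.
move=> w sg C.
have := small r0 (`|C| + 1) r00; apply: filterS3 (av w sg) dec => n h1 h2 h3.
apply: le_lt_trans h1; rewrite ler_pdivlMr ?exprn_gt0//.
have kth : kappa ^+ (n %/ L * N0) <= th ^- n.
  have : th ^+ n <= kappa ^- (n %/ L * N0).
    apply: le_trans (_ : th ^+ (L * (n %/ L)) <= _).
      by rewrite ler_wiXn2l ?(ltW th0) ?(ltW th1)// mulnC leq_trunc_div.
    by rewrite exprM mulnC exprM -exprVn lerXn2r// nnegrE ?exprn_ge0// ltW// invr_gt0 exprn_gt0.
  by rewrite -[leLHS]invrK lef_pV2// ?posrE ?invr_gt0 ?exprn_gt0.
set a := _ / _ in h2 *.
have a0 : 0 < a by rewrite divr_gt0.
have aK : a * kappa ^+ (n %/ L * N0) <= th ^+ n.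
  apply: le_trans (ler_pM (ltW a0) _ h2 kth) _; first by rewrite exprn_ge0// ltW.
  by rewrite exprMn mulfK// expf_neq0// gt_eqF.
rewrite -mulrA; apply: le_trans (ltW h3).
apply: le_trans (_ : `|C| * (a * kappa ^+ (n %/ L * N0)) <= _).
  by rewrite ler_wpM2r ?ler_norm// mulr_ge0 ?(ltW a0)// exprn_ge0// ltW.
rewrite mulrC; apply: ler_pM => //; last by rewrite lerDl.
by rewrite mulr_ge0 ?(ltW a0)// exprn_ge0// ltW.
Qed.

End AlmostEverywhere.

(** * The attractor is not contained in a line *)

Section NonCollinear.
Variables (R : realType) (m : nat).
Local Notation I := ('I_m.+2).
Variables (A : I -> 'M[R]_2) (b : I -> 'cV[R]_2) (E : set 'cV[R]_2).
Variables (rho kappa D delta : R).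
Hypothesis H : separated_ifs A b E rho kappa D delta.

(** A separated attractor in a line is totally disconnected.  At the supremum of
    the points of one first-level piece, points of that piece and of another
    one come closer than the gap. *)
Lemma no_segment_in_line (x d : 'cV[R]_2) : (forall z, E z -> exists s, z = x + s *: d) ->
  ~ (forall s1 s2 s, E (x + s1 *: d) -> E (x + s2 *: d) -> s1 <= s <= s2 -> E (x + s *: d)).
Proof.
move=> line conv.
have [z0 Ez0] : E !=set0 by case: (attractor H).
have delta0 := gap_gt0 H.
have piece z : E z -> exists a y, E y /\ z = aff_map A b a y.
  by case: (attractor H) => _ _ {1}-> [a _ [y Ey <-]]; exists a, y.
have disj a a' s s' y y' : a != a' -> E y -> E y' -> x + s *: d = aff_map A b a y ->
    x + s' *: d = aff_map A b a' y' -> delta < `|s - s'| * enorm d.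
  move=> aa' Ey Ey' e e'; have := gap_lt H aa' Ey Ey'.
  by rewrite -e -e' opprD addrACA subrr add0r -scalerBl enormZ.
have main a a' s s' y y' : a != a' -> E y -> E y' -> x + s *: d = aff_map A b a y ->
    x + s' *: d = aff_map A b a' y' -> ~ s < s'.
  move=> aa' Ey Ey' e e' ss'.
  have d0 : 0 < enorm d.
    rewrite lt_neqAle enorm_ge0 andbT; apply/negP => /eqP d0.
    have := disj _ _ _ _ _ _ aa' Ey Ey' e e'.
    by rewrite -d0 mulr0 => /(lt_trans delta0); rewrite ltxx.
  pose S := [set r | s <= r <= s' /\ exists2 y, E y & x + r *: d = aff_map A b a y].
  have Ss : S s by split; [rewrite lexx ltW|exists y].
  have hS : has_sup S by split; [exists s|exists s' => r [/andP[]]].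
  have s_sup : s <= sup S by apply: ub_le_sup => //; case: hS.
  have sup_s' : sup S <= s' by apply: ge_sup; [exists s|move=> r [/andP[]]].
  pose eps := delta / (2 * enorm d).
  have eps0 : 0 < eps by rewrite divr_gt0// mulr_gt0.
  have epsE : 2 * eps * enorm d = delta by rewrite /eps; field; rewrite gt_eqF.
  have [r [/andP[sr rs'] [yr Eyr er]] rsup] := sup_adherent eps0 hS.
  have r_sup : r <= sup S.
    by apply: ub_le_sup; [case: hS|split; [rewrite sr|exists yr]].
  pose t := Num.min (sup S + eps) s'.
  have t1 : t <= sup S + eps by rewrite ge_min lexx.
  have t2 : t <= s' by rewrite ge_min lexx orbT.
  have t3 : sup S <= t by rewrite le_min sup_s' lerDl ltW.
  have Exs : E (x + s *: d) by rewrite e; exact: aff_map_E H _ _ Ey.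
  have Exs' : E (x + s' *: d) by rewrite e'; exact: aff_map_E H _ _ Ey'.
  have Et : E (x + t *: d) by apply: (conv s s') => //; rewrite (le_trans s_sup).
  have [a2 [y2 [Ey2 e2]]] := piece _ Et.
  have a2a : a != a2.
    apply/eqP => a2a; rewrite -a2a in e2.
    have St : S t by split; [rewrite (le_trans s_sup)|exists y2].
    have : t <= sup S by apply: ub_le_sup => //; case: hS.
    have [h|h] := leP (sup S + eps) s'.
      by rewrite /t min_l// gerDl leNgt eps0.
    move=> _; have ts' : t = s' by rewrite /t min_r// ltW.
    rewrite ts' in e2; have := disj _ _ _ _ _ _ aa' Ey2 Ey' e2 e'.
    by rewrite subrr normr0 mul0r => /(lt_trans delta0); rewrite ltxx.
  have := disj _ _ _ _ _ _ a2a Eyr Ey2 er e2; apply/negP; rewrite -leNgt -epsE.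
  rewrite ler_wpM2r ?(ltW d0)// distrC ger0_norm; lra.
have Ey0 := Ez0.
have [s0 es0] := line _ (aff_map_E H ord0 Ez0).
have [s1 es1] := line _ (aff_map_E H ord_max Ez0).
have [h|h|e] := ltgtP s0 s1.
- exact: (@main ord0 ord_max s0 s1 z0 z0 isT Ez0 Ez0 (esym es0) (esym es1) h).
- exact: (@main ord_max ord0 s1 s0 z0 z0 isT Ez0 Ez0 (esym es1) (esym es0) h).
have := @disj ord0 ord_max s0 s1 z0 z0 isT Ez0 Ez0 (esym es0) (esym es1).
by rewrite e subrr normr0 mul0r => /(lt_trans delta0); rewrite ltxx.
Qed.

(** On a line the projection would be injective on [E], so that [E] itself
    would be a segment. *)
Lemma segment_projection_noncollinear v w : dot v v = 1 ->
  line_segment (proj_line v @` cyl_set A b E w) -> noncollinear E.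
Proof.
move=> vv hseg; apply: contrapT => hcol.
have col x0 x1 x2 : E x0 -> E x1 -> E x2 -> dot (x1 - x0) (perp (x2 - x0)) = 0.
  move=> E0 E1 E2; apply/eqP/negPn/negP => h; apply: hcol; by exists x0, x1, x2.
pose F z := dot (word_map A b w z) v.
have [x0 [x1 [E0 E1 F01]]] : exists x0 x1, [/\ E x0, E x1 & F x0 != F x1].
  case: hseg => u [u' [uu' e]].
  have i0 : (proj_line v @` cyl_set A b E w) u.
    by rewrite e; exists 0; rewrite ?scale0r ?addr0//= in_itv/= lexx ler01.
  have i1 : (proj_line v @` cyl_set A b E w) u'.
    by rewrite e; exists 1; rewrite ?scale1r ?subrKC//= in_itv/= lexx ler01.
  move: i0 i1 => [_ [x0 E0 <-] e0] [_ [x1 E1 <-] e1]; exists x0, x1; split => //.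
  apply: contra uu' => /eqP h; rewrite -e0 -e1 /proj_line.
  by rewrite -/(F x0) -/(F x1) h.
set d := x1 - x0.
have Fs s : F (x0 + s *: d) = F x0 + s * (F x1 - F x0).
  have Fb z z' : F z - F z' = dot (word_mx A w *m (z - z')) v.
    by rewrite /F -dotBl word_mapB.
  have e : (x0 + s *: d) - x0 = s *: d by rewrite addrC addKr.
  have := Fb (x0 + s *: d) x0; rewrite e -scalemxAr dotZl -Fb => <-.
  by rewrite [RHS]addrC subrK.
have d0 : dot d d != 0.
  apply: contra F01 => /eqP dd.
  have /enorm_eq0/subr0_eq -> : enorm d = 0 by rewrite /enorm dd sqrtr0.
  by [].
have line z : E z -> exists s, z = x0 + s *: d.
  move=> Ez; exists (dot (z - x0) d / dot d d).
  have := col _ _ _ E0 E1 Ez; rewrite -/d => h.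
  by rewrite mulrC -scalerA (perp_parallel h) scalerA mulVf// scale1r addrC subrK.
apply: (no_segment_in_line line) => s1 s2 s Es1 Es2 /andP[ss1 ss2].
have c z : E z -> cyl_set A b E w (word_map A b w z) by move=> Ez; exists z.
have back r z : E z -> F z = F (x0 + r *: d) -> E (x0 + r *: d).
  move=> Ez; have [r' ez] := line _ Ez; rewrite ez !Fs => /addrI/mulIf h.
  by rewrite -h -?ez// subr_eq0 eq_sym.
have [h|h] := leP (F x0) (F x1).
  have [|_ [z Ez <-] ez] := segment_projection_between (r := F (x0 + s *: d))
    vv hseg (c _ Es1) (c _ Es2).
    by rewrite -!/(F _) !Fs !lerD2l !ler_wpM2r ?subr_ge0.
  exact: back Ez ez.
have [|_ [z Ez <-] ez] := segment_projection_between (r := F (x0 + s *: d))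
    vv hseg (c _ Es2) (c _ Es1).
  by rewrite -!/(F _) !Fs !lerD2l !ler_wnM2r ?subr_le0 ?(ltW h).
exact: back Ez ez.
Qed.

End NonCollinear.

(** * From almost every code to almost every point *)

Section Transfer.
Variables (R : realType) (m : nat).
Local Notation I := ('I_m.+2).
Variables (A : I -> 'M[R]_2) (b : I -> 'cV[R]_2) (E : set 'cV[R]_2).
Variables (rho kappa D delta : R).
Hypothesis H : separated_ifs A b E rho kappa D delta.

Local Notation pi := (coding A b : code_space m -> borel_plane R).

Lemma closed_borel (C : set 'cV[R]_2) : closed C -> measurable (C : set (borel_plane R)).
Proof.
move=> cC; rewrite -[C]setCK; apply: measurableC.
by apply: sub_sigma_algebra; exact: closed_openC.
Qed.

(** The sets with Borel image form a sigma-algebra because the coding map is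
    injective with closed range; it contains the cylinders, whose images are
    compact. *)
Lemma coding_image_measurable (S : set (code_space m)) :
  measurable S -> measurable (pi @` S).
Proof.
move: S; apply: smallest_sub; last first.
  move=> _ [w _ <-]; have -> : pi @` cylinder w = cyl_set A b E w by exact: cyl_image H w.
  by apply: closed_borel; apply: (cyl_closed H).
split.
- by rewrite /= image_set0; exact: measurable0.
- move=> S mS; rewrite /=.
  have -> : pi @` ([set: code_space m] `\` S) = (E : set (borel_plane R)) `\` (pi @` S).
    apply/seteqP; split=> [_ [i [_ nSi] <-]|x [Ex nSx]].
      split; first exact: coding_E H i.
      by move=> [j Sj] /(coding_inj H) ji; apply: nSi; rewrite -ji.
    have [i ei] := coding_surj H Ex; exists i => //; split => // Si.
    by apply: nSx; exists i.
  by apply: measurableD => //; apply: closed_borel; exact: (E_closed H).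
- move=> F mF; rewrite /= image_bigcup; exact: bigcupT_measurable.
Qed.

Lemma coding_ae (nu : probability (code_space m) R) (P : set (code_space m)) :
  {ae nu, forall i, P i} ->
  {ae pushforward nu pi, forall x, E x -> exists2 i, coding A b i = x & P i}.
Proof.
move=> [N [mN N0 PN]]; exists (pi @` N); split.
- exact: coding_image_measurable.
- rewrite /pushforward; suff -> : pi @^-1` (pi @` N) = N by [].
  apply/seteqP; split=> [i [j Nj /(coding_inj H) <-]//|i Ni]; by exists i.
- move=> x /= hx; apply: contrapT => hno; apply: hx => Ex.
  have [i ei] := coding_surj H Ex; exists i => //.
  by apply: contrapT => nPi; apply: hno; exists i => //; apply: PN.
Qed.

End Transfer.

(** * The limit direction *)

Section Direction.
Variables (R : realType) (m : nat).
Local Notation I := ('I_m.+2).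
Variables (A : I -> 'M[R]_2) (b : I -> 'cV[R]_2) (E : set 'cV[R]_2).
Variables (alpha : 'I_2 -> seq I -> R) (eta : 'I_2 -> seq I -> 'cV[R]_2).
Hypothesis hsv : forall w, singular_system (word_mx A w) (alpha^~ w) (eta^~ w).

(** The default value of [vtheta_bar] is 0, so a nonzero value is a genuine
    limit of unit vectors. *)
Lemma vtheta_barP i : vtheta_bar A eta 0 i != 0 ->
  dot (vtheta_bar A eta 0 i) (vtheta_bar A eta 0 i) = 1 /\
  exists s : nat -> bool,
    (fun n => (-1) ^+ s n *: vtheta A eta 0 (trunc i n)) @ \oo --> vtheta_bar A eta 0 i.
Proof.
rewrite /vtheta_bar; case: xgetP => [v ev [s hs] _|]; last by rewrite eqxx.
split; last by exists s.
suff v1 : enorm v = 1 by rewrite -enorm_sqr v1 expr1n.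
apply/eqP; rewrite -subr_eq0 -normr_le0; apply/ler_addgt0Pr => e e0; rewrite add0r.
move/enorm_cvgP : hs => /(_ _ e0)/filter_ex[n hn].
set u := _ *: _ in hn.
have u1 : enorm u = 1.
  rewrite enormZ normrX normrN1 expr1n mul1r /enorm.
  by rewrite (left_singular_orth (hsv (trunc i n))) eqxx sqrtr1.
have := enorm_triangle u v 0; have := enorm_triangle v u 0.
rewrite !subr0 u1 (enormBC v u) => h1 h2.
by rewrite ler_norml; apply/andP; split; lra.
Qed.

Lemma line_segment_proj_neq0 (v : 'cV[R]_2) S : line_segment (proj_line v @` S) -> v != 0.
Proof.
move=> [u [u' [uu' e]]]; apply: contraNneq uu' => v0.
have p0 x : proj_line v x = 0 by rewrite /proj_line v0 scaler0.
have i0 : (proj_line v @` S) u.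
  by rewrite e; exists 0; rewrite ?scale0r ?addr0//= in_itv/= lexx ler01.
have i1 : (proj_line v @` S) u'.
  by rewrite e; exists 1; rewrite ?scale1r ?subrKC//= in_itv/= lexx ler01.
by move: i0 i1 => [x _ <-] [x' _ <-]; rewrite !p0.
Qed.

End Direction.

(** * The theorem *)

Theorem theorem3p1 (R : realType) (m : nat)
    (A : 'I_m.+2 -> 'M[R]_2) (b : 'I_m.+2 -> 'cV[R]_2) (hA : affine_ifs A)
    (E : set 'cV[R]_2) (hE : self_affine_set A b E)
    (p : 'I_m.+2 -> R) (p_gt0 : forall a, 0 < p a) (p_sum : \sum_a p a = 1)
    (nu : probability (code_space m) R) (hnu : bernoulli_measure p nu)
    (alpha : 'I_2 -> seq 'I_m.+2 -> R)
    (eta : 'I_2 -> seq 'I_m.+2 -> 'cV[R]_2)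
    (hsv : forall w, singular_system (word_mx A w) (alpha^~ w) (eta^~ w))
    (lambda : 'I_2 -> R) (hlambda : lyapunov_exponents nu alpha lambda)
    (separation : exists2 delta : R, 0 < delta &
      forall a a', a != a' ->
        delta < set_dist (aff_map A b a @` E) (aff_map A b a' @` E))
    (segments : {ae nu, forall i : code_space m,
      exists n0 : nat, forall n, (n0 <= n)%N -> forall w : seq 'I_m.+2,
        line_segment
          (proj_line (vtheta_bar A eta 0 i) @`
             cyl_set A b E (trunc i n ++ w))})
    (lyapunov_gap : lambda 0 < lambda 1) :
  {ae pushforward nu (coding A b : code_space m -> borel_plane R),
    forall x : borel_plane R, E x ->
    exists2 i : nat -> 'I_m.+2, coding A b i = x &
    exists O : 'M[R]_2,
      [/\ rotation O, O *m e1 = vtheta_bar A eta 0 i &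
        forall T : set 'cV[R]_2, tangent_set E x T ->
          (exists C : set R, [/\ closed C, porous C &
            T = mulmx O @` (plane_prod setT C `&` cball 0 1)])
          \/
          (exists l : interval R,
            (`[-1, 0] `<=` [set` l] \/ `[0, 1] `<=` [set` l]) /\
            T = mulmx O @` (plane_prod [set` l] [set 0] `&` cball 0 1))]}.
Proof.
have [rho /andP[rho0 rho1] hrho] := ifs_contraction hA.
have [kappa kappa1 hkappa] := ifs_expansion hA.
have [D D0 hD] : exists2 D : R, 0 < D & forall x y, E x -> E y -> enorm (x - y) <= D.
  by apply: compact_enorm_bounded; case: hE.
have [delta delta0 hdelta] := separation.
have H : separated_ifs A b E rho kappa D delta.
  split => //; first by move=> a; case: (hA a).
  move=> a a' x y aa' Ex Ey.
  apply: lt_le_trans (hdelta _ _ aa') _; apply: ge_inf.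
    by exists 0 => _ [? [? [_ _ ->]]]; exact: enorm_ge0.
  by exists (aff_map A b a x), (aff_map A b a' y).
have ncol : noncollinear E.
  have nuP : ProperFilter (almost_everywhere nu).
    by apply: ae_properfilter_algebraOfSetsType; rewrite [X in (_ < X)%E]probability_setT lte01.
  have [i [n0 hi]] := @filter_ex _ _ nuP _ segments.
  have hs := hi n0 (leqnn _) [::].
  have [vv _] := vtheta_barP hsv (line_segment_proj_neq0 hs).
  exact: (segment_projection_noncollinear H vv hs).
have gen := generic_ae H hsv p_gt0 p_sum hnu ncol hlambda lyapunov_gap.
have good : {ae nu, forall i : code_space m, exists O : 'M[R]_2,
    [/\ rotation O, O *m e1 = vtheta_bar A eta 0 i &
      forall T : set 'cV[R]_2, tangent_set E (coding A b i) T ->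
        exists C : set R, [/\ closed C, porous C &
          T = mulmx O @` (plane_prod setT C `&` cball 0 1)]]}.
  apply: filterS2 segments gen => i hi [gi ri].
  have [n0 hn0] := hi.
  have [vv [s hs]] := vtheta_barP hsv (line_segment_proj_neq0 (hn0 n0 (leqnn _) [::])).
  exists (frame (vtheta_bar A eta 0 i)); split.
  - exact: frame_rotation.
  - exact: frame_e1.
  - by move=> T; exact: (tangent_set_fibred H hsv vv hs hi ri gi).
have [N [mN N0 sub]] := coding_ae H good.
exists N; split => //; apply: subset_trans sub; apply: subsetC => x /= hx Ex.
have [i ix [Q [h1 h2 h3]]] := hx Ex; exists i => //; exists Q; split => // T hT.
by left; apply: h3; rewrite ix.
Qed.
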